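(* Let $M$ be a flat bi-Lagrangian manifold. For any field $(g,B)$ on $M$ there exists a unique double-metric connection $\nabla$ on $M$ with the following properties: 1) the Gualtieri torsion of $\nabla$ is zero; 2) the covariant deformation $\Psi(\mathbf X,\mathbf Y,\mathbf Z)=\gamma(\Theta(\mathbf X,\mathbf Y),\mathbf Z)$ of $\Theta=\nabla-\nabla^1$ (i.e. $\Theta(\mathbf X,\mathbf Y)=\nabla_{\mathbf X}\mathbf Y-\nabla^1_{\mathbf X}\mathbf Y$), where $\nabla^1$ is the CWT connection of the field, is totally skew-symmetric and is defined by $$\begin{aligned}3\,\mathrm{Alt}(\Psi)(\mathbf X,\mathbf Y,\mathbf Z)={}&\gamma([\mathbf X,\mathbf Y]_{\nabla^0},\mathbf Z)+\gamma([\mathbf Y,\mathbf Z]_{\nabla^0},\mathbf X)+\gamma([\mathbf X,\mathbf Z]_{\nabla^0},\mathbf Y)\\&-\tfrac12[\mathbf X(\gamma(\mathbf Y,\mathbf Z))-\mathbf Y(\gamma(\mathbf Z,\mathbf X))-3\mathbf Z(\gamma(\mathbf X,\mathbf Y))]\\&-[\gamma(\nabla^1_{\mathbf X}\mathbf Y,\mathbf Z)+\gamma(\nabla^1_{\mathbf Y}\mathbf Z,\mathbf X)+\gamma(\nabla^1_{\mathbf Z}\mathbf X,\mathbf Y)]\end{aligned}$$ for all vector fields $\mathbf X,\mathbf Y,\mathbf Z$ on $M$.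
   Context: Flat bi-Lagrangian (flat para-Kähler) manifold: a $2m$-dimensional manifold $M$ with an atlas of distinguished local coordinates $(x^i,\tilde x_i)$, $i=1,\dots,m$, whose coordinate changes are locally $x^i=\alpha^i_jx'^j+\alpha^i_0$, $\tilde x_i=\beta_i^k\tilde x'_k+\beta_i^0$ with constants satisfying $\alpha^i_j\beta_i^k=\delta_j^k$. $L$ and $\tilde L$ are the subbundles of $TM$ spanned by the $\partial/\partial x^i$ and by the $\partial/\partial\tilde x_i$, so $TM=L\oplus\tilde L$. $\gamma$ is the neutral metric with $L,\tilde L$ isotropic and $\gamma(\partial/\partial x^i,\partial/\partial\tilde x_j)=\delta_i^j$. $L^*$ is identified with $\mathrm{ann}\,\tilde L\subset T^*M$, and $L\oplus L^*$ with $TM$ by $(X,\alpha)\mapsto X+\sharp_\gamma\alpha$. $\nabla^0$ is the flat connection with $\nabla^0(\partial/\partial x^i)=0=\nabla^0(\partial/\partial\tilde x_i)$. With $[\,,\,]$ the Lie bracket, $[\mathbf X,\mathbf Y]_{\nabla^0}=[\mathbf X,\mathbf Y]-\mathbf X\wedge_{\nabla^0}\mathbf Y$, where $\gamma(\mathbf Z,\mathbf X\wedge_{\nabla^0}\mathbf Y)=\frac12[\gamma(\mathbf X,\nabla^0_{\mathbf Z}\mathbf Y)-\gamma(\mathbf Y,\nabla^0_{\mathbf Z}\mathbf X)]$. A field $(g,B)$ consists of a non-degenerate metric $g$ on the bundle $L$ with inertia indices $p,q$, $p+q=m$, and $B\in\Gamma\wedge^2L^*$. Put $\iota_\pm X=(X,\flat_{B\pm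 g}X)$, where $\flat_{B\pm g}X=i(X)B\pm g(X,\cdot)$, and $S_\pm=\iota_\pm(L)$; then $TM=S_+\oplus S_-$, and the generalized metric is $\mathcal H((X,\alpha),(Y,\beta))=g(X,Y)+g^{-1}(\flat_BX-\alpha,\flat_BY-\beta)$. A double-metric connection is a connection $\nabla$ on $TM$ preserving both $\gamma$ and $\mathcal H$. These correspond bijectively to pairs $D^\pm$ of $g$-preserving connections on the bundle $L$ over $M$, via $\nabla_{\mathbf Z}(\iota_\pm X)=\iota_\pm(D^\pm_{\mathbf Z}X)$. The Gualtieri torsion of $\nabla$ is the totally skew-symmetric tensor $$\mathcal T^\nabla(\mathbf X,\mathbf Y,\mathbf Z)=\gamma(\nabla_{\mathbf X}\mathbf Y-\nabla_{\mathbf Y}\mathbf X-[\mathbf X,\mathbf Y]_{\nabla^0},\mathbf Z)+\tfrac12\{\gamma(\nabla_{\mathbf Z}\mathbf X,\mathbf Y)-\gamma(\nabla_{\mathbf Z}\mathbf Y,\mathbf X)\}.$$ Its mixed torsion consists of the components with one argument in one of the subbundles $S_+,S_-$ and the two others in the other subbundle. The CWT (canonical with torsion) connection $\nabla^1$ of the field is the unique double-metric connection with vanishing mixed torsion such that, for its associated $D^\pm$, both partial connections $D^\pm_XY$ ($X,Y\in\Gamma L$) coincide with the Levi-Civita connection of $g$ along $L$, i.e. the unique partial connection $D$ on $L$ along $L$ that preserves $g$ and satisfies $D_XY-D_YX=[X,Y]$; its existence and uniqueness is a previous result of the paper. $\mathrm{Alt}$ is the alternation of a 3-covariant tensor, $\mathrm{Alt}(\Psi)(\mathbf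 X_1,\mathbf X_2,\mathbf X_3)=\frac16\sum_{\sigma}\mathrm{sgn}(\sigma)\Psi(\mathbf X_{\sigma(1)},\mathbf X_{\sigma(2)},\mathbf X_{\sigma(3)})$.
   Formalization: The CWT connection of the field is taken as given: the result holds for every field that has one. For indefinite g with B−g or B+g degenerate on L it may fail to exist, e.g. g=diag(1,−1,1), B=(1+x³)dx¹∧dx², so ''for any field'' is restricted to fields with a CWT connection. *)

(* Defs.v *)
(* MathComp + MathComp-Analysis *)
From HB Require Import structures.
From mathcomp Require Import all_boot all_order all_algebra.
From mathcomp Require Import all_classical all_reals all_analysis.
Set Implicit Arguments.
Unset Strict Implicit.
Unset Printing Implicit Defensive.
Import Order.TTheory GRing.Theory Num.Theory.
Import numFieldNormedType.Exports.
Local Open Scope classical_set_scope.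
Local Open Scope ring_scope.

(* Coordinate space of a point (x^i, ~x_i); also the space of components of a
   tangent vector u = u.1^i d/dx^i + u.2_i d/d~x_i. *)
Notation bivec R m := ('rV[R]_m * 'rV[R]_m)%type.

Section Smooth.
Context {R : realType} {V W : normedModType R}.

(* In finite dimension, f is k+1 times Frechet differentiable on the open set U
   iff it is differentiable on U and all its directional derivatives are k times
   differentiable on U. *)
Fixpoint differentiable_n (U : set V) (k : nat) (f : V -> W) : Prop :=
  if k is k'.+1 then
    (forall x, U x -> differentiable f x) /\
    (forall v, differentiable_n U k' (fun x => 'D_v f x))
  else True.

Definition smooth_on (U : set V) (f : V -> W) : Prop :=
  forall k, differentiable_n U k f.

End Smooth.

(* [param c] inverts the chart map [coord c] on the image of the chart domain. *)
Record flat_biLagrangian (R : realType) (m : nat) := FlatBiLagrangian {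
  pt :> topologicalType;
  chart : Type;
  dom : chart -> set pt;
  coord : chart -> pt -> bivec R m;
  param : chart -> bivec R m -> pt;
  pt_hausdorff : hausdorff_space pt;
  pt_second_countable : @second_countable pt;
  dom_cover : forall p, exists c, dom c p;
  dom_open : forall c, open (dom c);
  img_open : forall c, open (coord c @` dom c);
  coordK : forall c p, dom c p -> param c (coord c p) = p;
  coord_continuous : forall c p, dom c p -> {for p, continuous (coord c)};
  param_continuous : forall c e, (coord c @` dom c) e ->
    {for e, continuous (param c)};
  (* with A j i = alpha^i_j and A' k i = beta_i^k, the condition
     alpha^i_j beta_i^k = delta_j^k reads A *m A'^T = 1 *)
  flat_change : forall c c' p, dom c p -> dom c' p ->
    exists (A A' : 'M[R]_m) (a a' : 'rV[R]_m), A *m A'^T = 1%:M /\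
      (\forall q \near p,
         coord c q = ((coord c' q).1 *m A + a, (coord c' q).2 *m A' + a'))
}.

Section Geometry.
Context {R : realType} {m : nat} (M : flat_biLagrangian R m).

Local Notation E := (bivec R m).

(* A chart around p is chosen once and for all, and T_p M is identified with E
   through it.  Coordinate changes act on tangent vectors by
   (u, u') |-> (u *m A, u' *m A') with A *m A'^T = 1, so L_p = {u | u.2 = 0},
   ~L_p = {u | u.1 = 0} and gamma have chart-independent expressions. *)
Definition chart_at (p : M) : chart M := projT1 (cid (dom_cover p)).

(* components in the chart c of v in T_p M, for p in the domain of c *)
Definition comp (c : chart M) (p : M) (v : E) : E :=
  'd (coord c \o param (chart_at p)) (coord (chart_at p) p) v.

(* the vector field on the domain of c with constant components e in c *)
Definition coord_field (c : chart M) (e : E) (p : M) : E :=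
  'd (coord (chart_at p) \o param c) (coord c p) e.

Definition smooth_fun (f : M -> R) : Prop :=
  forall c, smooth_on (coord c @` dom c) (f \o param c).

Definition vector_field (X : M -> E) : Prop :=
  forall c, smooth_on (coord c @` dom c)
              (fun e => comp c (param c e) (X (param c e))).

(* L_p is identified with 'rV[R]_m, and likewise L^*_p (dual basis). *)
Definition inL (x : 'rV[R]_m) : E := (x, 0).

Definition sectionL (X : M -> 'rV[R]_m) : Prop := vector_field (inL \o X).

Definition bil (A : 'M[R]_m) (x y : 'rV[R]_m) : R := (x *m A *m y^T) 0 0.

(* smoothness of a section of L^* (x) L^*: the components in every chart *)
Definition smooth_form (h : M -> 'M[R]_m) : Prop :=
  forall (c : chart M) (i j : 'I_m),
    smooth_on (coord c @` dom c)
      (fun e => bil (h (param c e))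
                  (coord_field c (delta_mx 0 i, 0) (param c e)).1
                  (coord_field c (delta_mx 0 j, 0) (param c e)).1).

Definition gamma (u v : E) : R := (u.1 *m v.2^T) 0 0 + (v.1 *m u.2^T) 0 0.

Definition gam (X Y : M -> E) : M -> R := fun p => gamma (X p) (Y p).

(* the vector w with gamma z w = a z for all z, for a linear form a *)
Definition sharp (a : E -> R) : E :=
  (\row_i a (0, delta_mx 0 i), \row_i a (delta_mx 0 i, 0)).

Definition lder (X : M -> E) (f : M -> R) : M -> R :=
  fun p => 'D_(X p) (f \o param (chart_at p)) (coord (chart_at p) p).

(* The connection for which the coordinate fields are parallel: the components
   of nabla0 along v in T_p M are the derivatives of those of Y. *)
Definition nabla0_at (p : M) (v : E) (Y : M -> E) : E :=
  'D_v (fun e => comp (chart_at p) (param (chart_at p) e)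
                   (Y (param (chart_at p) e)))
       (coord (chart_at p) p).

Definition nabla0 (X Y : M -> E) : M -> E := fun p => nabla0_at p (X p) Y.

(* [X, Y]^a = X(Y^a) - Y(X^a) in local coordinates *)
Definition lie_bracket (X Y : M -> E) : M -> E :=
  fun p =>
    let c := chart_at p in
    let in_c (Z : M -> E) := fun e => comp c (param c e) (Z (param c e)) in
    'D_(X p) (in_c Y) (coord c p) - 'D_(Y p) (in_c X) (coord c p).

Definition wedge0 (X Y : M -> E) : M -> E :=
  fun p => sharp (fun z => 2^-1 * (gamma (X p) (nabla0_at p z Y)
                                   - gamma (Y p) (nabla0_at p z X))).

Definition bracket0 (X Y : M -> E) : M -> E :=
  fun p => lie_bracket X Y p - wedge0 X Y p.

(* Connections, partial or not: a covariant derivative of the sections S of a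
   vector bundle with fibre W, along the sections A of a subbundle of TM with
   fibre V, included in TM by anc.  The operators are constrained on sections
   only; their values on other functions are irrelevant. *)
Definition is_connection (V W : lmodType R) (anc : V -> E)
    (A : (M -> V) -> Prop) (S : (M -> W) -> Prop)
    (D : (M -> V) -> (M -> W) -> M -> W) : Prop :=
  [/\ forall X Y, A X -> S Y -> S (D X Y),
      forall X X' Y, A X -> A X' -> S Y ->
        D (fun p => X p + X' p) Y = (fun p => D X Y p + D X' Y p),
      forall X Y Y', A X -> S Y -> S Y' ->
        D X (fun p => Y p + Y' p) = (fun p => D X Y p + D X Y' p),
      forall f X Y, smooth_fun f -> A X -> S Y ->
        D (fun p => f p *: X p) Y = (fun p => f p *: D X Y p)
    & forall f X Y, smooth_fun f -> A X -> S Y ->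
        D X (fun p => f p *: Y p)
        = (fun p => lder (anc \o X) f p *: Y p + f p *: D X Y p)].

Definition preserves (V W : lmodType R) (anc : V -> E)
    (A : (M -> V) -> Prop) (S : (M -> W) -> Prop)
    (h : (M -> W) -> (M -> W) -> M -> R)
    (D : (M -> V) -> (M -> W) -> M -> W) : Prop :=
  forall X Y Z, A X -> S Y -> S Z ->
    lder (anc \o X) (h Y Z) = (fun p => h (D X Y) Z p + h Y (D X Z) p).

Definition connectionTM (nabla : (M -> E) -> (M -> E) -> M -> E) : Prop :=
  is_connection id vector_field vector_field nabla.

Definition gualtieri_torsion (nabla : (M -> E) -> (M -> E) -> M -> E)
    (X Y Z : M -> E) : M -> R :=
  fun p =>
    gamma (nabla X Y p - nabla Y X p - bracket0 X Y p) (Z p)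
    + 2^-1 * (gamma (nabla Z X p) (Y p) - gamma (nabla Z Y p) (X p)).

Section Field.
Variables (p q : nat) (g B : M -> 'M[R]_m).

Definition has_inertia (G : 'M[R]_m) : Prop :=
  exists2 T : 'M[R]_m, T \in unitmx &
    T *m G *m T^T = diag_mx (\row_(i < m) if (i < p)%N then 1 else -1).

(* (g x) i j = g(d/dx^i, d/dx^j) and (B x) i j = B(d/dx^i, d/dx^j) in T_x M *)
Definition is_field : Prop :=
  [/\ (p + q)%N = m,
      smooth_form g,
      forall x, [/\ (g x)^T = g x, g x \in unitmx & has_inertia (g x)],
      smooth_form B
    & forall x, (B x)^T = - B x].

Definition gL (X Y : M -> 'rV[R]_m) : M -> R := fun x => bil (g x) (X x) (Y x).

(* iota false = iota_+ and iota true = iota_-; L + L^* is identified with TM by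
   (X, alpha) |-> X + sharp alpha, which has components (X, alpha). *)
Definition iota (s : bool) (X : M -> 'rV[R]_m) : M -> E :=
  fun x => (X x, X x *m (B x + (-1) ^+ s *: g x)).

Definition gen_metric (U V : M -> E) : M -> R :=
  fun x => bil (g x) (U x).1 (V x).1
           + bil (invmx (g x)) ((U x).1 *m B x - (U x).2)
                               ((V x).1 *m B x - (V x).2).

Definition double_metric (nabla : (M -> E) -> (M -> E) -> M -> E) : Prop :=
  [/\ connectionTM nabla,
      preserves id vector_field vector_field gam nabla
    & preserves id vector_field vector_field gen_metric nabla].

(* s1, s2, s3 not all equal: one argument is in one of the two subbundles S_+,
   S_- and the two others in the other one *)
Definition mixed_torsion_free (nabla : (M -> E) -> (M -> E) -> M -> E) : Prop :=
  forall (s1 s2 s3 : bool) (X Y Z : M -> 'rV[R]_m),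
    ~~ ((s1 == s2) && (s2 == s3)) ->
    sectionL X -> sectionL Y -> sectionL Z ->
    gualtieri_torsion nabla (iota s1 X) (iota s2 Y) (iota s3 Z) = (fun=> 0).

Definition levi_civitaL
    (D : (M -> 'rV[R]_m) -> (M -> 'rV[R]_m) -> M -> 'rV[R]_m) : Prop :=
  [/\ is_connection inL sectionL sectionL D,
      preserves inL sectionL sectionL gL D
    & forall X Y, sectionL X -> sectionL Y ->
        (fun x => inL (D X Y x - D Y X x))
        = lie_bracket (inL \o X) (inL \o Y)].

(* D false = D^+ and D true = D^-, the pair of connections associated to nabla *)
Definition associated_pair (nabla : (M -> E) -> (M -> E) -> M -> E)
    (D : bool -> (M -> E) -> (M -> 'rV[R]_m) -> M -> 'rV[R]_m) : Prop :=
  forall s : bool,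
    [/\ is_connection id vector_field sectionL (D s),
        preserves id vector_field sectionL gL (D s)
      & forall Z X, vector_field Z -> sectionL X ->
          nabla Z (iota s X) = iota s (D s Z X)].

Definition CWT (nabla : (M -> E) -> (M -> E) -> M -> E) : Prop :=
  [/\ double_metric nabla,
      mixed_torsion_free nabla
    & exists2 D, associated_pair nabla D &
        forall s : bool, levi_civitaL (fun X Y => D s (inL \o X) Y)].

Definition torsion_free (nabla : (M -> E) -> (M -> E) -> M -> E) : Prop :=
  forall X Y Z, vector_field X -> vector_field Y -> vector_field Z ->
    gualtieri_torsion nabla X Y Z = (fun=> 0).

Definition deformation (nabla nabla1 : (M -> E) -> (M -> E) -> M -> E)
    (X Y Z : M -> E) : M -> R :=
  fun x => gamma (nabla X Y x - nabla1 X Y x) (Z x).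

Definition totally_skew (Psi : (M -> E) -> (M -> E) -> (M -> E) -> M -> R) :
    Prop :=
  forall X Y Z, vector_field X -> vector_field Y -> vector_field Z ->
    Psi Y X Z = (fun x => - Psi X Y Z x) /\
    Psi X Z Y = (fun x => - Psi X Y Z x).

Definition Alt (Psi : (M -> E) -> (M -> E) -> (M -> E) -> M -> R)
    (X Y Z : M -> E) : M -> R :=
  fun x => 6^-1 * (Psi X Y Z x + Psi Y Z X x + Psi Z X Y x
                   - Psi Y X Z x - Psi X Z Y x - Psi Z Y X x).

End Field.
End Geometry.

(* Main.v *)
Require Import Defs.
From HB Require Import structures.
From mathcomp Require Import all_boot all_order all_algebra.
From mathcomp Require Import all_classical all_reals all_analysis.
From mathcomp Require Import ring lra.
Set Implicit Arguments.
Unset Strict Implicit.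
Unset Printing Implicit Defensive.
Import Order.TTheory GRing.Theory Num.Theory.
Import numFieldNormedType.Exports.
Local Open Scope classical_set_scope.
Local Open Scope ring_scope.

(** Let T be the Gualtieri torsion of the given connection nabla1, and let Psi be
    the lowered difference of another connection nabla with nabla1.  If Psi is
    totally skew, the torsion of nabla is T + 3 Psi: the two derivatives along X
    and Y contribute 2 Psi, and the half difference of derivatives along Z
    contributes Psi.  Zero torsion therefore forces Psi = - T / 3, which is the
    uniqueness, and the existence means that
      nabla = nabla1 - (1/3) T^sharp
    is a double-metric connection with a totally skew deformation satisfying the
    formula.  This rests on three properties of T.

    Symmetry.  nabla0 and nabla1 both preserve gamma, hence
    d(X, Y, Z) = gamma(nabla1_X Y - nabla0_X Y, Z) is skew in Y and Z, and T turns
    out to be the sum of d over cyclic permutations (torsion_cyclic).  So T is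
    totally skew (torsion_skew12, torsion_skew23), and nabla preserves gamma.
    The same expansion in terms of nabla0 turns the right-hand side of the formula
    into - T, which is 3 Alt(Psi).

    Tensoriality.  T is linear over the smooth functions in its last argument
    (torsion_tensorial), thus in all of them by skewness.  Connections being
    operators on global fields, T^sharp exists as a smooth field, and T can be
    evaluated at a point, only because there are enough global fields: bump
    functions built from exp(-1/x) extend coordinate fields to the whole manifold
    (smooth_bump, chart_cutoff), which gives pointwise dependence (tensorial_eq)
    and duality (tensorial_riesz).

    Compatibility with the splitting.  If J is the involution equal to 1 on S_+
    and to -1 on S_-, the generalized metric of U and V is gamma(J U, V)
    (gen_metric_involution).  Preserving it amounts to T(X, Y, J Z) = T(X, J Y, Z),
    which holds as the mixed components of T are zero (torsion_involution). *)

(** * Smooth functions on normed spaces *)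

Section SmoothCalculus.
Context {R : realType}.

Lemma differentiable_near (V W : normedModType R) (f g : V -> W) (x : V) :
  (\forall y \near x, f y = g y) -> differentiable f x -> differentiable g x.
Proof.
move=> fg fx; have [dc dE] := (diff_locallyP _ _).1 fx.
have gE : g \o shift x = cst (g x) + 'd f x +o_ 0 id.
  move/eqaddoP : dE => dE; apply/eqaddoP => e e0.
  near=> h.
  have -> : ((g \o shift x) - (cst (g x) + 'd f x : V -> W)) h
          = ((f \o shift x) - (cst (f x) + 'd f x : V -> W)) h.
    rewrite !fctE /= (nbhs_singleton fg); congr (_ - _).
    by apply/esym; near: h; move: fg; rewrite (near_shift 0 x) subr0.
  by near: h; exact: dE.
apply/diff_locallyP; rewrite (diff_unique dc gE); split => //.
Unshelve. all: by end_near. Qed.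

Lemma near_eq_near (V : topologicalType) (W : Type) (f g : V -> W) (x : V) :
  (\forall y \near x, f y = g y) -> \forall y \near x, \forall z \near y, f z = g z.
Proof. by move=> fg; apply: (near_join fg). Qed.

Section Germs.
Context {V W : normedModType R}.
Implicit Types (f g : V -> W) (U : set V).

Lemma differentiable_n_set1 U k f :
  differentiable_n U k f <-> forall x, U x -> differentiable_n [set x] k f.
Proof.
elim: k f => [|k IH] f //=; split.
  move=> [fU Df] x Ux; split=> [_ ->|v]; first exact: fU.
  exact: (IH _).1 (Df v) x Ux.
move=> H; split=> [x Ux|v]; first exact: (H x Ux).1.
by apply/IH => x Ux; exact: (H x Ux).2.
Qed.

(** Only the germs of f at the points of U matter, since the iterated derivatives
    are those of the globally given function. *)
Lemma smooth_on_set1 U f :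
  smooth_on U f <-> forall x, U x -> smooth_on [set x] f.
Proof.
split=> [H x Ux k|H k]; first exact: (differentiable_n_set1 U k f).1 (H k) x Ux.
by apply/differentiable_n_set1 => x Ux; exact: H.
Qed.

Lemma smooth_on_sub U U' f : U' `<=` U -> smooth_on U f -> smooth_on U' f.
Proof. by move=> UU /smooth_on_set1 H; apply/smooth_on_set1 => x /UU /H. Qed.

Lemma smooth_on_near x f g :
  (\forall y \near x, f y = g y) -> smooth_on [set x] f -> smooth_on [set x] g.
Proof.
move=> fg H k; move: f g fg {H}(H k); elim: k => [//|k IH] f g fg /= [fx Df].
split=> [_ ->|v]; first by apply: (differentiable_near fg); exact: fx.
apply: IH (Df v); near=> y; apply: near_eq_derive.
by near: y; exact: near_eq_near.
Unshelve. all: by end_near. Qed.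

Lemma smooth_on_eq U f g : open U -> (forall x, U x -> f x = g x) ->
  smooth_on U f -> smooth_on U g.
Proof.
move=> oU fg /smooth_on_set1 H; apply/smooth_on_set1 => x Ux.
apply: smooth_on_near (H x Ux); near=> y; apply: fg.
by near: y; exact: open_nbhs_nbhs.
Unshelve. all: by end_near. Qed.

Lemma smooth_on_differentiable U f x : smooth_on U f -> U x -> differentiable f x.
Proof. by move=> /(_ 1%N)[fU _]; exact: fU. Qed.

Lemma smooth_on_derive U f v : smooth_on U f -> smooth_on U (fun x => 'D_v f x).
Proof. by move=> H k; exact: (H k.+1).2. Qed.

(** The way every closure property below is obtained: a class of differentiable
    functions whose directional derivatives are sums of two members of the class
    consists of smooth functions.  Two summands suffice because the derivatives
    met here come from a product rule. *)
Lemma smooth_on_derive_closed U (C : (V -> W) -> Prop) : open U ->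
  (forall f x, C f -> U x -> differentiable f x) ->
  (forall f v, C f -> exists g h, [/\ C g, C h &
     forall x, U x -> 'D_v f x = g x + h x]) ->
  forall f, C f -> smooth_on U f.
Proof.
move=> oU Cd CD.
(* S n is the class of sums of 2 ^ n members of C; deriving goes from S n to
   S n.+1. *)
pose S := fix S k f := if k is k'.+1 then
    exists g h, [/\ S k' g, S k' h & forall x, U x -> f x = g x + h x]
  else C f.
suff H k : forall n f, S n f -> differentiable_n U k f.
  by move=> f Cf k; exact: (H k 0).
have Sd : forall n f x, S n f -> U x -> differentiable f x.
  elim=> [|n IH] f x /=; first exact: Cd.
  move=> [g [h [Sg Sh fgh]]] Ux.
  apply: (@differentiable_near _ _ (g + h)).
    near=> y; rewrite fgh //; near: y; exact: open_nbhs_nbhs.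
  by apply: differentiableD; apply: IH.
have SD : forall n f v, S n f -> S n.+1 (fun x => 'D_v f x).
  elim=> [|n IH] f v; first by move=> /CD; exact.
  move=> [g [h [Sg Sh fgh]]].
  exists (fun x => 'D_v g x), (fun x => 'D_v h x); split; [exact: IH..|].
  move=> x Ux; rewrite (@near_eq_derive _ _ _ _ (g + h)).
    by rewrite deriveD //; apply: diff_derivable; apply: Sd Ux; eassumption.
  near=> y; rewrite fgh //; near: y; exact: open_nbhs_nbhs.
elim: k => [//|k IH] n f Sf /=; split=> [x|v]; first exact: Sd Sf.
exact/IH/SD/Sf.
Unshelve. all: by end_near. Qed.

End Germs.

Lemma smooth_on_cst (V W : normedModType R) (U : set V) (a : W) :
  open U -> smooth_on U (fun=> a).
Proof.
move=> oU; apply: (@smooth_on_derive_closed _ _ _ (fun f => exists b, f = cst b)) => //.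
- by move=> f x [b ->] _; exact: differentiable_cst.
- move=> f v [b ->]; exists (cst 0), (cst 0); split; [by exists 0..|].
  by move=> x _; rewrite derive_cst /cst addr0.
- by exists a.
Qed.

Lemma smooth_onD (V W : normedModType R) (U : set V) (f g : V -> W) : open U ->
  smooth_on U f -> smooth_on U g -> smooth_on U (fun x => f x + g x).
Proof.
move=> oU sf sg.
apply: (@smooth_on_derive_closed _ _ _ (fun h => exists f' g', [/\ smooth_on U f',
  smooth_on U g' & h = f' + g'])) => //; last by exists f, g.
- move=> _ x [f' [g' [sf' sg' ->]]] Ux.
  by apply: differentiableD; apply: smooth_on_differentiable Ux.
- move=> _ v [f' [g' [sf' sg' ->]]].
  exists (fun x => 'D_v f' x), (fun x => 'D_v g' x); split.
  + exists (fun x => 'D_v f' x), (cst 0); split.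
    * exact: smooth_on_derive.
    * exact: smooth_on_cst.
    * by apply/funext => x; rewrite !fctE addr0.
  + exists (cst 0), (fun x => 'D_v g' x); split.
    * exact: smooth_on_cst.
    * exact: smooth_on_derive.
    * by apply/funext => x; rewrite !fctE add0r.
  + by move=> x Ux; rewrite deriveD //; apply: diff_derivable;
      apply: smooth_on_differentiable Ux.
Qed.

Lemma derive_scale (V W : normedModType R) (f : V -> R) (g : V -> W) x :
  differentiable f x -> differentiable g x ->
  differentiable (fun y => f y *: g y) x /\
  forall v, 'D_v (fun y => f y *: g y) x = 'D_v f x *: g x + f x *: 'D_v g x.
Proof.
move=> df dg.
have bl : bilinear_for (GRing.Scale.Law.clone _ _ *:%R _)
    (GRing.Scale.Law.clone _ _ *:%R _) (@GRing.scale R W).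
  by split=> [u|u] a y z /=; rewrite ?scalerDl ?scalerDr !scalerA // mulrC.
pose blM := bilinear_isBilinear.Build R R W W _ _ _ bl.
pose b : {bilinear R -> W -> W} := HB.pack (@GRing.scale R W) blM.
have cb : continuous (fun p : R * W => b p.1 p.2) by exact: scale_continuous.
have db : differentiable (fun p : R * W => b p.1 p.2) (f x, g x).
  exact: differentiable_bilin.
have dfg := differentiable_pair df dg.
have dZ : differentiable (fun y => f y *: g y) x.
  exact: (@differentiable_comp _ _ _ _ (fun y => (f y, g y))
           (fun p : R * W => b p.1 p.2)).
split=> // v; rewrite !deriveE //.
rewrite (@diff_comp _ _ _ _ (fun y => (f y, g y)) (fun p : R * W => b p.1 p.2)) //=.
rewrite diff_pair //.
have E := congr1 (fun h => h ('d f x v, 'd g x v)) (@diff_bilin _ _ _ _ b (f x, g x) cb).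
by rewrite [LHS]E /= addrC.
Qed.

Lemma smooth_onZ (V W : normedModType R) (U : set V) (f : V -> R) (g : V -> W) :
  open U -> smooth_on U f -> smooth_on U g -> smooth_on U (fun x => f x *: g x).
Proof.
move=> oU sf sg.
apply: (@smooth_on_derive_closed _ _ _ (fun h => exists (f' : V -> R) (g' : V -> W),
  [/\ smooth_on U f',
  smooth_on U g' & h = fun x => f' x *: g' x])) => //; last by exists f, g.
- move=> _ x [f' [g' [sf' sg' ->]]] Ux.
  by apply: (derive_scale _ _).1; apply: smooth_on_differentiable Ux.
- move=> _ v [f' [g' [sf' sg' ->]]].
  exists (fun x => 'D_v f' x *: g' x), (fun x => f' x *: 'D_v g' x); split.
  + by exists (fun x => 'D_v f' x), g'; split => //; exact: smooth_on_derive.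
  + by exists f', (fun x => 'D_v g' x); split => //; exact: smooth_on_derive.
  + by move=> x Ux; apply: (derive_scale _ _).2; apply: smooth_on_differentiable Ux.
Qed.

Lemma smooth_onM (V : normedModType R) (U : set V) (f g : V -> R) :
  open U -> smooth_on U f -> smooth_on U g -> smooth_on U (fun x => f x * g x).
Proof. exact: smooth_onZ. Qed.

Lemma smooth_on_linear (V W : normedModType R) (U : set V) (l : {linear V -> W}) :
  open U -> continuous l -> smooth_on U l.
Proof.
move=> oU cl k; case: k => [//|k] /=; split=> [x _|v].
  exact: linear_differentiable.
have -> : (fun x => 'D_v l x) = cst (l v).
  apply/funext => x; rewrite deriveE ?diff_lin //.
  exact: linear_differentiable.
exact: smooth_on_cst.
Qed.

Lemma smooth_on_linear_comp (V W W' : normedModType R) (U : set V) (f : V -> W)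
    (l : {linear W -> W'}) :
  open U -> continuous l -> smooth_on U f -> smooth_on U (l \o f).
Proof.
move=> oU cl sf; have dl y : differentiable l y by exact: linear_differentiable.
apply: (@smooth_on_derive_closed _ _ _ (fun h => exists f', smooth_on U f' /\ h = l \o f'))
  => //; last by exists f.
- move=> _ x [f' [sf' ->]] Ux; apply: differentiable_comp => //.
  exact: smooth_on_differentiable Ux.
- move=> _ v [f' [sf' ->]]; exists (l \o (fun x => 'D_v f' x)), (l \o cst 0).
  split.
  + by eexists; split; [exact: smooth_on_derive sf'|].
  + by exists (cst 0); split => //; exact: smooth_on_cst.
  + move=> x Ux; rewrite [(l \o cst 0) x]linear0 addr0.
    have df' : differentiable f' x by exact: smooth_on_differentiable Ux.
    rewrite /= !deriveE //; last exact: differentiable_comp.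
    by rewrite diff_comp // diff_lin.
Qed.

Lemma smooth_on_affine_precomp (V V' W : normedModType R) (U : set V) (U' : set V')
    (l : {linear V' -> V}) (b : V) (f : V -> W) :
  open U -> open U' -> continuous l -> (forall x, U' x -> U (l x + b)) ->
  smooth_on U f -> smooth_on U' (fun x => f (l x + b)).
Proof.
move=> oU oU' cl UU sf.
have da y : differentiable (fun x => l x + b) y.
  by apply: differentiableD; [exact: linear_differentiable|exact: differentiable_cst].
have dav y : 'd (fun x => l x + b) y = l :> (_ -> _).
  rewrite (diffD _ (differentiable_cst b y)); last exact: linear_differentiable.
  by rewrite diff_cst diff_lin //; apply/funext => v; rewrite /= addr0.
apply: (@smooth_on_derive_closed _ _ _ (fun h => exists (f' : V -> W),
  smooth_on U f' /\ h = fun x => f' (l x + b))) => //; last by exists f.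
- move=> _ x [f' [sf' ->]] Ux.
  apply: (@differentiable_comp _ _ _ _ (fun x => l x + b) f') => //.
  by apply: smooth_on_differentiable (UU _ Ux).
- move=> _ v [f' [sf' ->]]; exists (fun x => 'D_(l v) f' (l x + b)), (cst 0).
  split.
  + by exists (fun x => 'D_(l v) f' x); split => //; exact: smooth_on_derive.
  + by exists (cst 0); split => //; exact: smooth_on_cst.
  + move=> x Ux; rewrite [_ + cst 0 x]addr0.
    have df' : differentiable f' (l x + b).
      by apply: smooth_on_differentiable (UU _ Ux).
    rewrite !deriveE //; last first.
      exact: (@differentiable_comp _ _ _ _ (fun x => l x + b) f').
    by rewrite (@diff_comp _ _ _ _ (fun x => l x + b) f') // dav.
Qed.

(** The functions (psi o f) * k, with psi smooth on the line and k smooth on U,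
    form a class to which the chain and product rules apply. *)
Lemma smooth_on_comp1 (V : normedModType R) (U : set V) (phi : R -> R) (f : V -> R) :
  open U -> smooth_on setT phi -> smooth_on U f -> smooth_on U (phi \o f).
Proof.
move=> oU sphi sf.
suff : smooth_on U (fun x => phi (f x) * 1)
  by move=> h; apply: smooth_on_eq h => // x _; rewrite mulr1.
have oT : open (@setT R) by exact: openT.
apply: (@smooth_on_derive_closed _ _ _ (fun h => exists (psi : R -> R) (k : V -> R),
  [/\ smooth_on setT psi, smooth_on U k & h = fun x => psi (f x) *: k x])) => //;
  last by exists phi, (cst 1); split => //; exact: smooth_on_cst.
- move=> _ x [psi [k [spsi sk ->]]] Ux.
  apply: (derive_scale _ _).1; last exact: smooth_on_differentiable Ux.
  apply: (@differentiable_comp _ _ _ _ f psi).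
    exact: smooth_on_differentiable Ux.
  exact: (smooth_on_differentiable spsi).
- move=> _ v [psi [k [spsi sk ->]]].
  exists (fun x => 'D_1 psi (f x) *: ('D_v f x *: k x)), (fun x => psi (f x) *: 'D_v k x).
  split.
  + exists (fun y => 'D_1 psi y), (fun x => 'D_v f x *: k x); split => //.
      exact: smooth_on_derive.
    by apply: smooth_onZ => //; exact: smooth_on_derive.
  + by exists psi, (fun x => 'D_v k x); split => //; exact: smooth_on_derive.
  + move=> x Ux.
    have df : differentiable f x by exact: smooth_on_differentiable Ux.
    have dpsi : differentiable psi (f x) by exact: (smooth_on_differentiable spsi).
    have dk : differentiable k x by exact: smooth_on_differentiable Ux.
    have dc : differentiable (fun x => psi (f x)) x.
      exact: (@differentiable_comp _ _ _ _ f psi).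
    rewrite (derive_scale dc dk).2 /GRing.scale /= mulrA; congr (_ * _ + _).
    rewrite !deriveE // (@diff_comp _ _ _ _ f psi) //=.
    by rewrite -[X in 'd psi _ X]mulr1 [LHS]linearZ mulrC.
Qed.

Lemma diff_affine (V W : normedModType R) (l : {linear V -> W}) b (f : V -> W) x :
  continuous l -> (\forall y \near x, f y = l y + b) ->
  differentiable f x /\ forall v, 'd f x v = l v.
Proof.
move=> cl fl.
have dl : differentiable l x by exact: linear_differentiable.
have dlb : differentiable ((l : V -> W) + cst b) x.
  by apply: differentiableD => //; exact: differentiable_cst.
have df : differentiable f x.
  apply: differentiable_near dlb.
  by apply: filterS fl => y ->.
split=> // v; rewrite -deriveE // (@near_eq_derive _ _ _ _ ((l : V -> W) + cst b)).
  rewrite deriveE // diffD // diff_cst diff_lin //= addr0 //.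
by apply: filterS fl => y ->.
Qed.

Lemma derive_linear (V W W' : normedModType R) (l : {linear W -> W'}) (h : V -> W) x v :
  continuous l -> differentiable h x ->
  differentiable (fun e => l (h e)) x /\ 'D_v (fun e => l (h e)) x = l ('D_v h x).
Proof.
move=> cl dh; have dl y : differentiable l y by exact: linear_differentiable.
have d : differentiable (l \o h) x by exact: differentiable_comp.
by split=> //; rewrite !deriveE // diff_comp // diff_lin.
Qed.

Lemma derive_bigsum (V W : normedModType R) (I : Type) (r : seq I)
    (h : I -> V -> W) x v : (forall i, differentiable (h i) x) ->
  differentiable (fun e => \sum_(i <- r) h i e) x /\
  'D_v (fun e => \sum_(i <- r) h i e) x = \sum_(i <- r) 'D_v (h i) x.
Proof.
move=> dh; elim: r => [|i r [IHd IHD]].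
  have -> : (fun e => \sum_(i <- [::]) h i e) = cst 0.
    by apply/funext => e; rewrite big_nil.
  by split; [exact: differentiable_cst|rewrite derive_cst big_nil].
have -> : (fun e => \sum_(i <- i :: r) h i e) =
    (h i + (fun e => \sum_(i <- r) h i e)).
  by apply/funext => e; rewrite big_cons.
split; first exact: differentiableD.
by rewrite deriveD ?IHD ?big_cons //; exact: diff_derivable.
Qed.

(** The chain rule for two functions related by affine changes of the source
    and linear changes of the target, as two coordinate expressions of a field
    on a flat manifold are. *)
Lemma derive_intertwine (V V' W W' : normedModType R) (l : {linear V -> V'}) b
    (k : {linear W -> W'}) (g : V -> W) (f : V' -> W') x v :
  continuous l -> continuous k ->
  (\forall e \near x, f (l e + b) = k (g e)) ->
  differentiable g x -> differentiable f (l x + b) ->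
  k ('D_v g x) = 'D_(l v) f (l x + b).
Proof.
move=> cl ck fg dg df; have [_ <-] := derive_linear v ck dg.
rewrite -(near_eq_derive v fg).
have [da Da] : differentiable (fun e => l e + b) x /\
    forall v, 'd (fun e => l e + b) x v = l v.
  by apply: (diff_affine cl); near=> e.
rewrite !deriveE //; last first.
  exact: (@differentiable_comp _ _ _ _ (fun e => l e + b) f).
by rewrite (@diff_comp _ _ _ _ (fun e => l e + b) f) //= Da.
Unshelve. all: by end_near. Qed.

End SmoothCalculus.

(** * A flat function and cut-offs of the line *)

Section Bump.
Context {R : realType}.

(** For x > 0 this is x^-n exp(-1/x).  The negative powers are kept along so
    that the derivatives stay in the linear span of the family. *)
Definition exp_inv (n : nat) (x : R) : R :=
  if 0 < x then x^-1 ^+ n * expR (- x^-1) else 0.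

Lemma exp_inv_le0 n x : x <= 0 -> exp_inv n x = 0.
Proof. by rewrite /exp_inv ltNge => ->. Qed.

Lemma exp_inv_gt0 n x : 0 < x -> 0 < exp_inv n x.
Proof. by move=> x0; rewrite /exp_inv x0 mulr_gt0 ?expR_gt0 ?exprn_gt0 ?invr_gt0. Qed.

Lemma exp_invS n x : exp_inv n x = exp_inv n.+1 x * x.
Proof.
rewrite /exp_inv; case: ifPn => x0; last by rewrite mul0r.
by rewrite exprSr mulrAC mulfVK // gt_eqF.
Qed.

(** With y = 1/x this says y^(n+1) <= (n+1)^(n+1) exp(y), which holds because
    exp(y) = exp(y/(n+1))^(n+1) and exp(t) >= t. *)
Lemma exp_inv_bound n x : `|exp_inv n x| <= n.+1%:R ^+ n.+1 * `|x|.
Proof.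
have [x0|x0] := leP x 0; first by rewrite exp_inv_le0 // normr0 mulr_ge0 ?exprn_ge0.
rewrite !gtr0_norm ?exp_inv_gt0 // /exp_inv x0; set y := x^-1.
have y0 : 0 < y by rewrite invr_gt0.
rewrite expRN ler_pdivrMr ?expR_gt0 // -(ler_pM2r y0) -exprSr mulrAC.
rewrite [_ * x * y](_ : _ = n.+1%:R ^+ n.+1) ?mulfVK ?gt_eqF // /y; last first.
  by rewrite -mulrA mulfV ?gt_eqF // mulr1.
have -> : expR x^-1 = expR (x^-1 / n.+1%:R) ^+ n.+1.
  by rewrite -expRM_natl mulrC divfK // pnatr_eq0.
rewrite -exprMn lerXn2r ?nnegrE ?mulr_ge0 ?expR_ge0 ?invr_ge0 ?(ltW x0) //.
rewrite -ler_pdivrMl ?ltr0Sn // mulrC.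
by apply: le_trans (expR_ge1Dx _); rewrite lerDr.
Qed.

Lemma is_derive_exp_inv n (x : R) :
  is_derive x 1 (exp_inv n) (exp_inv n.+2 x - n%:R * exp_inv n.+1 x).
Proof.
have [x0|x0|->] := ltgtP x 0.
- rewrite !exp_inv_le0 ?ltW // mulr0 subr0.
  apply: (@near_eq_is_derive _ _ _ (cst 0)).
  by near=> y; rewrite exp_inv_le0 // ltW //; near: y; exact: lt_nbhsl.
- have dV : is_derive x 1 (fun y : R => y^-1) (- x ^- 2 *: 1).
    by apply: (@is_deriveV _ id); rewrite ?gt_eqF.
  have dE : is_derive x 1 (expR \o (fun y : R => - y^-1))
      (expR (- x^-1) * - (- x ^- 2 *: 1)).
    by apply: is_derive1_comp.
  apply: (@near_eq_is_derive _ _ _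
    ((fun y : R => y^-1) ^+ n * (expR \o (fun y : R => - y^-1)))).
    near=> y; rewrite /exp_inv ifT ?fctE //=; near: y; exact: lt_nbhsr.
  have -> : exp_inv n.+2 x - n%:R * exp_inv n.+1 x =
     ((fun y : R => y^-1) ^+ n) x *: (expR (- x^-1) * - (- x ^- 2 *: 1))
     + (expR \o (fun y : R => - y^-1)) x *:
       ((n%:R * ((fun y : R => y^-1) x) ^+ n.-1) *: (- x ^- 2 *: 1)).
    rewrite /exp_inv x0 exprfctE /GRing.scale /=.
    case: n => [|n] /=; rewrite ?mul0r -?exprVn !exprS ?expr0; ring.
  exact: (is_deriveM (is_deriveX n dV) dE).
- (* at the origin, the difference quotient of exp_inv n is exp_inv n.+1 *)
  rewrite !exp_inv_le0 // mulr0 subr0; apply/is_derive1_caratheodory.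
  exists (exp_inv n.+1); split.
  + by move=> z; rewrite [exp_inv n 0]exp_inv_le0 // !subr0 exp_invS.
  + suff: exp_inv n.+1 y @[y --> (0 : R)] --> (0 : R).
      by rewrite -[X in _ --> X -> _](exp_inv_le0 n.+1 (lexx 0)).
    apply/cvgr0Pnorm_le => e e0.
    have c0 : 0 < (n.+2%:R ^+ n.+2)^-1 * e.
      by rewrite mulr_gt0 ?invr_gt0 ?exprn_gt0.
    have : \forall y \near (0 : R), `|y| <= (n.+2%:R ^+ n.+2)^-1 * e.
      exact: (@cvgr0_norm_le _ _ _ (nbhs (0 : R)) _ id cvg_id _ c0).
    apply: filterS => y ye; apply: le_trans (exp_inv_bound _ _) _.
    by rewrite -ler_pdivlMl ?exprn_gt0.
  + exact: exp_inv_le0.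
Unshelve. all: by end_near. Qed.

Lemma smooth_exp_inv n : smooth_on setT (exp_inv n).
Proof.
apply: (@smooth_on_derive_closed _ _ _ _ (fun f => exists c k, f = fun x => c * exp_inv k x));
  last by exists 1, n; apply/funext => x; rewrite mul1r.
- exact: openT.
- move=> _ x [c [k ->]] _; apply: differentiableM; first exact: differentiable_cst.
  by apply/derivable1_diffP; have [] := is_derive_exp_inv k x.
- move=> _ v [c [k ->]].
  exists (fun x => (v * c) * exp_inv k.+2 x), (fun x => (- (v * c * k%:R)) * exp_inv k.+1 x).
  split; [by do 2 eexists..|] => x _.
  have [dk Dk] := is_derive_exp_inv k x.
  have dd : differentiable (fun x => c * exp_inv k x) x.
    apply: differentiableM; first exact: differentiable_cst.
    exact/derivable1_diffP.
  rewrite deriveE // -[X in 'd _ _ X]mulr1 [LHS]linearZ -deriveE // deriveMl //.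
  rewrite Dk; change (v * (c * (exp_inv k.+2 x - k%:R * exp_inv k.+1 x)) =
    v * c * exp_inv k.+2 x + - (v * c * k%:R) * exp_inv k.+1 x :> R).
  ring.
Qed.

(** With h = exp_inv 0, the function h(h(b - a) - h(t - a)) is constant and
    positive for t <= a because h(t - a) = 0 there, and vanishes for t >= b
    because h is nondecreasing; only a constant has to be divided out. *)
Lemma smooth_cutoff (a b : R) : a < b -> exists psi : R -> R,
  [/\ smooth_on setT psi, forall t, t <= a -> psi t = 1
    & forall t, b <= t -> psi t = 0].
Proof.
move=> ab; pose h := exp_inv 0.
have h0 : h (b - a) > 0 by rewrite exp_inv_gt0 // subr_gt0.
exists (fun t => (h (h (b - a)))^-1 * h (h (b - a) - h (t - a))); split.
- apply: smooth_onM; [exact: openT|apply: smooth_on_cst; exact: openT|].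
  apply: (smooth_on_comp1 openT (smooth_exp_inv 0)).
  have sh : smooth_on setT (fun t => h (t - a)).
    apply: (@smooth_on_affine_precomp _ R R R setT setT idfun (- a) h) => //.
    - exact: openT.
    - exact: openT.
    - by move=> x; exact: cvg_id.
    - exact: smooth_exp_inv.
  have sN : smooth_on setT (fun t => h (b - a) + (- 1) * h (t - a)).
    apply: smooth_onD; [exact: openT|apply: smooth_on_cst; exact: openT|].
    apply: smooth_onM => //; [exact: openT|apply: smooth_on_cst; exact: openT].
  by apply: smooth_on_eq sN => [|t _]; [exact: openT|rewrite mulN1r].
- move=> t ta; rewrite [h (t - a)]exp_inv_le0 ?subr_le0 // subr0 mulVf //.
  by rewrite gt_eqF // exp_inv_gt0.
- move=> t bt; rewrite [h (h _ - _)]exp_inv_le0 ?mulr0 // subr_le0.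
  have t1 : 0 < t - a by lra. have b1 : 0 < b - a by lra.
  rewrite /h /exp_inv t1 b1 !expr0 !mul1r ler_expR lerN2 lef_pV2 ?posrE //; lra.
Qed.
End Bump.

(** * Germs of smooth functions *)

Section SmoothAt.
Context {R : realType}.

(** The algebraic closure properties hold on open sets only, hence the open
    neighbourhood instead of the single point x. *)
Definition smooth_at {V W : normedModType R} (x : V) (f : V -> W) : Prop :=
  exists2 U, open_nbhs x U & smooth_on U f.

Lemma smooth_on_at (V W : normedModType R) (U : set V) x (f : V -> W) :
  open U -> U x -> smooth_on U f -> smooth_at x f.
Proof. by move=> oU Ux sf; exists U. Qed.

Lemma smooth_at_on (V W : normedModType R) (U : set V) (f : V -> W) :
  (forall x, U x -> smooth_at x f) -> smooth_on U f.
Proof.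
move=> H; apply/smooth_on_set1 => x /H[U' [oU' U'x] sf].
by apply: smooth_on_sub sf => _ ->.
Qed.

Lemma smooth_at_near (V W : normedModType R) x (f g : V -> W) :
  (\forall y \near x, f y = g y) -> smooth_at x f -> smooth_at x g.
Proof.
move=> fgx; have : nbhs x [set y | f y = g y] by exact: fgx.
rewrite nbhsE => -[A [oA Ax] fg] [U [oU Ux] sf]; exists (A `&` U).
  by split; [exact: openI|].
apply: (@smooth_on_eq _ _ _ _ f); [exact: openI|by move=> y [/fg]|].
by apply: smooth_on_sub sf => y [].
Qed.

Lemma smooth_at_differentiable (V W : normedModType R) x (f : V -> W) :
  smooth_at x f -> differentiable f x.
Proof. by move=> [U [oU Ux] sf]; exact: smooth_on_differentiable Ux. Qed.

Lemma smooth_at_cst (V W : normedModType R) (x : V) (a : W) :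
  smooth_at x (fun=> a).
Proof. by exists setT; [split => //; exact: openT|apply: smooth_on_cst; exact: openT]. Qed.

Lemma smooth_at2 (V W W' W'' : normedModType R) x (f : V -> W) (g : V -> W')
    (h : V -> W'') :
  (forall U, open U -> smooth_on U f -> smooth_on U g -> smooth_on U h) ->
  smooth_at x f -> smooth_at x g -> smooth_at x h.
Proof.
move=> H [U [oU Ux] sf] [U' [oU' Ux'] sg]; exists (U `&` U').
  by split; [exact: openI|].
by apply: H; [exact: openI|apply: smooth_on_sub sf|apply: smooth_on_sub sg] => y [].
Qed.

Lemma smooth_atD (V W : normedModType R) x (f g : V -> W) :
  smooth_at x f -> smooth_at x g -> smooth_at x (fun y => f y + g y).
Proof. by apply: smooth_at2 => U; exact: smooth_onD. Qed.

Lemma smooth_atZ (V W : normedModType R) x (f : V -> R) (g : V -> W) :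
  smooth_at x f -> smooth_at x g -> smooth_at x (fun y => f y *: g y).
Proof. by apply: smooth_at2 => U; exact: smooth_onZ. Qed.

Lemma smooth_atM (V : normedModType R) x (f g : V -> R) :
  smooth_at x f -> smooth_at x g -> smooth_at x (fun y => f y * g y).
Proof. exact: smooth_atZ. Qed.

Lemma smooth_at_sum (V W : normedModType R) x (I : Type) (r : seq I)
    (f : I -> V -> W) : (forall i, smooth_at x (f i)) ->
  smooth_at x (fun y => \sum_(i <- r) f i y).
Proof.
move=> sf; elim: r => [|i r IH].
  under [X in smooth_at _ X]funext do rewrite big_nil; exact: smooth_at_cst.
by under [X in smooth_at _ X]funext do rewrite big_cons; exact: smooth_atD.
Qed.

Lemma smooth_at_derive (V W : normedModType R) x (f : V -> W) v :
  smooth_at x f -> smooth_at x (fun y => 'D_v f y).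
Proof. by move=> [U nU sf]; exists U => //; exact: smooth_on_derive. Qed.

Lemma smooth_at_linear_comp (V W W' : normedModType R) x (f : V -> W)
    (l : {linear W -> W'}) :
  continuous l -> smooth_at x f -> smooth_at x (fun y => l (f y)).
Proof. by move=> cl [U [oU Ux] sf]; exists U => //; exact: smooth_on_linear_comp. Qed.

Lemma smooth_at_affine_precomp (V V' W : normedModType R) (x : V')
    (l : {linear V' -> V}) (b : V) (f : V -> W) :
  continuous l -> smooth_at (l x + b) f -> smooth_at x (fun y => f (l y + b)).
Proof.
move=> cl [U [oU Ux] sf].
have oU' : open ((fun y => l y + b) @^-1` U).
  apply: open_comp => // y _.
  by apply: (@continuousD _ _ _ l (fun=> b)); [exact: cl|exact: cvg_cst].
by exists ((fun y => l y + b) @^-1` U) => //; exact: smooth_on_affine_precomp sf.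
Qed.

End SmoothAt.

(** * Linear algebra and bump functions on the coordinate space *)

Section Bivec.
Context {R : realType} {m : nat}.
Local Notation E := (bivec R m).

(** The coordinates (x^i, ~x_i) are indexed by a disjoint sum, so that sums
    over all of them are single sums. *)
Definition coordE (i : 'I_m + 'I_m) (e : E) : R :=
  match i with inl i => e.1 0 i | inr i => e.2 0 i end.

Definition basE (i : 'I_m + 'I_m) : E :=
  match i with inl i => (delta_mx 0 i, 0) | inr i => (0, delta_mx 0 i) end.

Lemma sum_pair (U W : nmodType) (I : Type) (r : seq I) (F : I -> U * W) :
  \sum_(i <- r) F i = (\sum_(i <- r) (F i).1, \sum_(i <- r) (F i).2).
Proof.
by elim: r => [|i r IH]; rewrite ?big_nil // !big_cons IH.
Qed.

Lemma decompE (e : E) : e = \sum_i coordE i e *: basE i.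
Proof.
case: e => a b; rewrite sum_pair; congr (_, _); rewrite big_sumType /=.
  rewrite [X in _ + X]big1 ?addr0; last by move=> i _; rewrite scaler0.
  exact: row_sum_delta.
rewrite [X in X + _]big1 ?add0r; last by move=> i _; rewrite scaler0.
exact: row_sum_delta.
Qed.

Lemma coordE_is_linear i : linear (coordE i).
Proof. by case: i => i a u v /=; rewrite !mxE. Qed.

Definition coordE_linear i : {linear E -> R} :=
  HB.pack (coordE i) (GRing.isLinear.Build _ _ _ _ _ (coordE_is_linear i)).

Lemma coordE_continuous i : continuous (coordE i).
Proof.
case: i => i e.
  apply: (@continuous_comp _ _ _ fst (fun v : 'rV[R]_m => v 0 i)).
    exact: cvg_fst.
  exact: coord_continuous.
apply: (@continuous_comp _ _ _ snd (fun v : 'rV[R]_m => v 0 i)).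
  exact: cvg_snd.
exact: coord_continuous.
Qed.

Lemma smooth_at_coordE i (e : E) : smooth_at e (coordE i).
Proof.
exists setT; first by split => //; exact: openT.
by apply: (@smooth_on_linear _ _ _ _ (coordE_linear i));
  [exact: openT|exact: coordE_continuous].
Qed.

(** The dimension being finite, a linear map is a combination of coordinates. *)
Lemma linear_smooth (W : normedModType R) (l : {linear E -> W}) e : smooth_at e l.
Proof.
apply: (@smooth_at_near _ _ _ _ (fun e => \sum_i coordE i e *: l (basE i))).
  by near=> y; rewrite [in RHS](decompE y) linear_sum; under [RHS]eq_bigr do rewrite linearZ.
apply: smooth_at_sum => i; apply: smooth_atZ; [exact: smooth_at_coordE|exact: smooth_at_cst].
Unshelve. all: by end_near. Qed.

Lemma linear_continuousE (W : normedModType R) (l : {linear E -> W}) : continuous l.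
Proof.
by move=> e; apply/differentiable_continuous/smooth_at_differentiable/linear_smooth.
Qed.

Lemma smooth_at_coords (V : normedModType R) (x : V) (f : V -> E) :
  smooth_at x f <-> forall i, smooth_at x (fun y => coordE i (f y)).
Proof.
split=> [sf i|sf].
  by apply: (@smooth_at_linear_comp _ _ _ _ _ _ (coordE_linear i)) sf;
    exact: coordE_continuous.
apply: (@smooth_at_near _ _ _ _ (fun y => \sum_i coordE i (f y) *: basE i)).
  by near=> y; rewrite -decompE.
by apply: smooth_at_sum => i; apply: smooth_atZ => //; exact: smooth_at_cst.
Unshelve. all: by end_near. Qed.

(** Smoothness only speaks of constant directions; for a varying direction X the
    derivative is the combination of the derivatives along the basis vectors with
    the components of X as coefficients. *)
Lemma smooth_at_dir_derive (W : normedModType R) (x : E) (X : E -> E) (f : E -> W) :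
  smooth_at x X -> smooth_at x f -> smooth_at x (fun y => 'D_(X y) f y).
Proof.
move=> sX sf; apply: (@smooth_at_near _ _ _ _
    (fun y => \sum_i coordE i (X y) *: 'D_(basE i) f y)).
  have [U [oU Ux] sU] := sf; near=> y.
  have dy : differentiable f y.
    apply: smooth_on_differentiable sU _; near: y; exact: open_nbhs_nbhs.
  rewrite deriveE // [in RHS](decompE (X y)) linear_sum.
  by apply: eq_bigr => i _; rewrite linearZ deriveE.
apply: smooth_at_sum => i; apply: smooth_atZ; last exact: smooth_at_derive.
by move/smooth_at_coords: sX.
Unshelve. all: by end_near. Qed.

(** The basis is gamma-dual to itself up to this exchange of indices. *)
Definition dualI (i : 'I_m + 'I_m) : 'I_m + 'I_m :=
  match i with inl i => inr i | inr i => inl i end.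

Lemma gammaE (u v : E) : gamma u v = \sum_i coordE i u * coordE (dualI i) v.
Proof.
rewrite big_sumType /= /gamma !mxE; congr (_ + _); apply: eq_bigr => i _;
  by rewrite !mxE // mulrC.
Qed.

Lemma gamma_basE (u : E) i : gamma u (basE (dualI i)) = coordE i u.
Proof.
case: i => i; rewrite /gamma /=.
  by rewrite mul0mx [X in _ + X]mxE addr0 trmx_delta -colE mxE.
by rewrite trmx0 mulmx0 [X in X + _]mxE add0r -rowE !mxE.
Qed.

Lemma gamma_linear_r (u : E) : linear (gamma u).
Proof.
move=> a v w; rewrite !gammaE scaler_sumr -big_split /=; apply: eq_bigr => i _.
by rewrite (coordE_is_linear (dualI i)) mulrDr mulrCA.
Qed.

Lemma gammaC (u v : E) : gamma u v = gamma v u.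
Proof. by rewrite /gamma addrC. Qed.

Lemma gammaDr (u v w : E) : gamma u (v + w) = gamma u v + gamma u w.
Proof. by have := gamma_linear_r u 1 v w; rewrite !scale1r. Qed.

Lemma gammaDl (u v w : E) : gamma (v + w) u = gamma v u + gamma w u.
Proof. by rewrite gammaC gammaDr !(gammaC u). Qed.

Lemma gamma0r (u : E) : gamma u 0 = 0.
Proof. by apply: (addrI (gamma u 0)); rewrite -gammaDr !addr0. Qed.

Lemma gammaZr (a : R) (u v : E) : gamma u (a *: v) = a * gamma u v.
Proof. by have := gamma_linear_r u a v 0; rewrite gamma0r !addr0. Qed.

Lemma gammaZl (a : R) (u v : E) : gamma (a *: v) u = a * gamma v u.
Proof. by rewrite gammaC gammaZr gammaC. Qed.

Lemma gammaNr (u v : E) : gamma u (- v) = - gamma u v.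
Proof. by rewrite -scaleN1r gammaZr mulN1r. Qed.

Lemma gammaNl (u v : E) : gamma (- v) u = - gamma v u.
Proof. by rewrite gammaC gammaNr gammaC. Qed.

Lemma gamma_nondeg (u v : E) : (forall w, gamma u w = gamma v w) -> u = v.
Proof.
move=> H; rewrite (decompE u) (decompE v); apply: eq_bigr => i _.
by rewrite -!gamma_basE H.
Qed.

Lemma gamma_sharp (a : E -> R) z : linear a -> gamma (sharp a) z = a z.
Proof.
move=> la; pose l : {linear E -> R} :=
  HB.pack a (GRing.isLinear.Build _ _ _ _ _ la).
have -> : a z = l z by [].
rewrite [in RHS](decompE z) linear_sum gammaC gammaE; apply: eq_bigr => i _.
by rewrite linearZ; case: i => i /=; rewrite mxE.
Qed.

Lemma derive_gamma (h k : E -> E) (x v : E) :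
  differentiable h x -> differentiable k x ->
  'D_v (fun e => gamma (h e) (k e)) x =
    gamma ('D_v h x) (k x) + gamma (h x) ('D_v k x).
Proof.
move=> dh dk; pose c i (h : E -> E) e := coordE i (h e).
have dc i (h' : E -> E) : differentiable h' x -> differentiable (c i h') x /\
    'D_v (c i h') x = coordE i ('D_v h' x).
  move=> dh'; apply: (derive_linear (l := coordE_linear i) v) => //.
  exact: coordE_continuous.
have dM i : differentiable (fun e => c i h e * c (dualI i) k e) x /\
    'D_v (fun e => c i h e * c (dualI i) k e) x =
    coordE i ('D_v h x) * coordE (dualI i) (k x)
    + coordE i (h x) * coordE (dualI i) ('D_v k x).
  have [d1 D1] := dc i _ dh; have [d2 D2] := dc (dualI i) _ dk.
  have [d3 D3] := derive_scale d1 d2.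
  by split; [exact: d3|rewrite [LHS](D3 v) D1 D2].
have -> : (fun e => gamma (h e) (k e)) =
    (fun e => \sum_i c i h e * c (dualI i) k e).
  by apply/funext => e; rewrite gammaE.
rewrite (derive_bigsum _ _ (fun i => (dM i).1)).2 !gammaE -big_split /=.
by apply: eq_bigr => i _; rewrite (dM i).2.
Qed.

(** The cut-off of the line is composed with the squared Euclidean distance to
    e0.  The norm is the maximum norm, so the support is confined to a cube. *)
Lemma smooth_bump (U : set E) (e0 : E) : open U -> U e0 ->
  exists (phi : E -> R) (K : set E),
  [/\ smooth_on setT phi, compact K, K `<=` U,
      \forall e \near e0, phi e = 1 & forall e, ~ K e -> phi e = 0].
Proof.
move=> oU Ue0; have : nbhs e0 U by exact: open_nbhs_nbhs.
move=> /nbhs_ballP[r /= r0 rU].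
(* r is the radius of a ball contained in U; the bump is 1 at Euclidean distance
   at most r/4 from e0, and 0 outside the cube K of half-side r/2 *)
have [psi [spsi psi1 psi0]] : exists psi : R -> R, [/\ smooth_on setT psi,
    forall t, t <= (r / 4) ^+ 2 -> psi t = 1
    & forall t, (r / 2) ^+ 2 <= t -> psi t = 0].
  by apply: smooth_cutoff; rewrite ltr_pXn2r // ?nnegrE; lra.
pose rho (e : E) := \sum_i (coordE i e - coordE i e0) * (coordE i e - coordE i e0).
have srho e : smooth_at e rho.
  apply: smooth_at_sum => i; apply: smooth_atM;
    by apply: smooth_atD; [exact: smooth_at_coordE|exact: smooth_at_cst].
pose K : set E := [set e | forall i, `|coordE i e - coordE i e0| <= r / 2].
exists (psi \o rho), K; split.
- by apply: smooth_on_comp1 => //; [exact: openT|exact: smooth_at_on].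
- pose S (c : R) : set R := [set t | `|t - c| <= r / 2].
  have cS c : compact (S c).
    have -> : S c = `[c - r / 2, c + r / 2]%classic.
      by apply/seteqP; split => t; rewrite /S /= in_itv /= ler_distl.
    exact: segment_compact.
  have -> : K = [set v : 'rV[R]_m | forall i, S (e0.1 0 i) (v ord0 i)] `*`
                [set v : 'rV[R]_m | forall i, S (e0.2 0 i) (v ord0 i)].
    apply/seteqP; split => [e Ke|e [K1 K2] [] i]; [|exact: K1|exact: K2].
    by split=> i; [exact: (Ke (inl i))|exact: (Ke (inr i))].
  apply: compact_setX.
    exact: (@rV_compact R m (fun i => S (e0.1 0 i)) (fun i => cS _)).
  exact: (@rV_compact R m (fun i => S (e0.2 0 i)) (fun i => cS _)).
- move=> e Ke; apply: rU; split.
    split => // i j; rewrite -ball_normE /= distrC (ord1 i).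
    by apply: le_lt_trans (Ke (inl j)) _; lra.
  split => // i j; rewrite -ball_normE /= distrC (ord1 i).
  by apply: le_lt_trans (Ke (inr j)) _; lra.
- have crho : {for e0, continuous rho}.
    exact/differentiable_continuous/smooth_at_differentiable.
  have r1 : 0 < (r / 4) ^+ 2 by rewrite exprn_gt0 //; lra.
  have rho0 : rho e0 = 0 by rewrite /rho big1 // => i _; rewrite subrr mul0r.
  near=> e; rewrite /= psi1 //.
  have : `|rho e0 - rho e| < (r / 4) ^+ 2.
    by near: e; exact: (@cvgr_dist_lt _ _ _ (nbhs e0) _ rho (rho e0) crho _ r1).
  by rewrite rho0 sub0r normrN => /ltW; apply: le_trans; exact: ler_norm.
- move=> e; rewrite /K /= => /existsNP[i /negP]; rewrite -ltNge => ri.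
  apply: psi0; rewrite /rho (bigD1 i) //=.
  apply: le_trans (_ : (coordE i e - coordE i e0) * (coordE i e - coordE i e0) <= _).
    by rewrite -expr2 -[leRHS]real_normK ?num_real // lerXn2r ?nnegrE //; lra.
  by rewrite lerDl sumr_ge0 // => j _; rewrite -expr2 sqr_ge0.
Unshelve. all: by end_near. Qed.

End Bivec.

(** * Changes of flat coordinates *)

Section Charts.
Context {R : realType} {m : nat} (M : flat_biLagrangian R m).
Local Notation E := (bivec R m).
Local Notation coord := Defs.coord.
Implicit Types (c : chart M) (p q : M) (X Y Z : M -> E) (f : M -> R).

(** The linear part of a change of flat coordinates when A *m A'^T = 1. *)
Definition frame_change (A A' : 'M[R]_m) (v : E) : E := (v.1 *m A, v.2 *m A').

Lemma frame_change_is_linear A A' : linear (frame_change A A').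
Proof.
by move=> a u v; rewrite /frame_change /= !mulmxDl -!scalemxAl.
Qed.
HB.instance Definition _ A A' :=
  GRing.isLinear.Build _ _ _ _ (frame_change A A') (frame_change_is_linear A A').

Lemma frame_change_continuous A A' : continuous (frame_change A A').
Proof. exact: linear_continuousE. Qed.

Lemma frame_changeK A A' : A *m A'^T = 1%:M ->
  cancel (frame_change A A') (frame_change A'^T A^T).
Proof.
move=> AA [u v]; rewrite /frame_change /= -!mulmxA AA mulmx1.
by rewrite -[A' *m A^T]trmxK trmx_mul trmxK AA trmx1 mulmx1.
Qed.

Lemma frame_changeVK A A' : A *m A'^T = 1%:M ->
  cancel (frame_change A'^T A^T) (frame_change A A').
Proof.
move=> /mulmx1C AA [u v]; rewrite /frame_change /= -!mulmxA AA mulmx1.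
by rewrite -[A^T *m A']trmxK trmx_mul trmxK AA trmx1 mulmx1.
Qed.

Lemma gamma_frame_change A A' u v : A *m A'^T = 1%:M ->
  gamma (frame_change A A' u) (frame_change A A' v) = gamma u v.
Proof.
move=> AA; rewrite /gamma /frame_change /= !trmx_mul !mulmxA.
by rewrite -2!(mulmxA _ A) AA !mulmx1.
Qed.

Lemma near_param c p (P : M -> Prop) : dom c p ->
  (\forall q \near p, P q) -> \forall e \near coord c p, P (param c e).
Proof.
move=> cp; rewrite -{1}(coordK cp) => H.
have ce : (coord c @` dom c) (coord c p) by exists p.
exact: (param_continuous ce).
Qed.

Lemma near_coord c p (P : E -> Prop) : dom c p ->
  (\forall e \near coord c p, P e) -> \forall q \near p, P (coord c q).
Proof. by move=> cp; exact: (Defs.coord_continuous cp). Qed.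

Lemma near_dom c p : dom c p -> \forall q \near p, dom c q.
Proof. by move=> cp; exact: (open_nbhs_nbhs (conj (dom_open c) cp)). Qed.

Lemma near_img c p : dom c p ->
  \forall e \near coord c p, dom c (param c e) /\ coord c (param c e) = e.
Proof.
move=> cp; have H : \forall e \near coord c p, (coord c @` dom c) e.
  by apply: open_nbhs_nbhs; split; [exact: img_open|exists p].
by apply: filterS H => _ [q cq <-]; rewrite coordK.
Qed.

Lemma transition c c' p : dom c p -> dom c' p ->
  exists A A' b, A *m A'^T = 1%:M /\
    \forall q \near p, coord c q = frame_change A A' (coord c' q) + b.
Proof.
move=> cp c'p; have [A [A' [a [a' [AA H]]]]] := flat_change cp c'p.
by exists A, A', (a, a').
Qed.

Lemma diff_chart_change c c' p A A' b : dom c' p ->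
  (\forall q \near p, coord c q = frame_change A A' (coord c' q) + b) ->
  differentiable (coord c \o param c') (coord c' p) /\
  forall v, 'd (coord c \o param c') (coord c' p) v = frame_change A A' v.
Proof.
move=> c'p H; apply: diff_affine; first exact: linear_continuousE.
apply: filterS2 (near_param c'p H) (near_img c'p) => e /= -> [_ ->] //.
Qed.

Lemma dom_chart_at p : dom (chart_at p) p.
Proof. exact: projT2 (cid (dom_cover p)). Qed.

(** In any chart, the components of a tangent vector arise from the reference
    frame at p by a frame change, and coord_field is the inverse of it. *)
Lemma comp_frame_change c p : dom c p -> exists A A',
  [/\ A *m A'^T = 1%:M, forall v, Defs.comp c p v = frame_change A A' v
    & forall e, coord_field c e p = frame_change A'^T A^T e].
Proof.
move=> cp; have c0p := dom_chart_at p.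
have [A [A' [b [AA H]]]] := transition cp c0p.
exists A, A'; split => //; first exact: (diff_chart_change c0p H).2.
apply: (diff_chart_change (b := - frame_change A'^T A^T b) cp _).2.
apply: filterS H => q ->.
by rewrite linearD /= frame_changeK // addrK.
Qed.

Lemma comp_chart_at p v : Defs.comp (chart_at p) p v = v.
Proof.
have c0p := dom_chart_at p.
rewrite /Defs.comp.
have [|_ ->] := @diff_chart_change (chart_at p) (chart_at p) p 1%:M 1%:M 0 c0p.
  by near=> q; rewrite addr0 /frame_change !mulmx1 -surjective_pairing.
by rewrite /frame_change !mulmx1 -surjective_pairing.
Unshelve. all: by end_near. Qed.

(** The reference charts used at nearby points q differ, but the same constant
    frame change relates the components in c and in c' at all of them: the
    reference chart of q cancels by composition of transition maps. *)
Lemma comp_transition c c' p : dom c p -> dom c' p ->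
  exists A A' b, A *m A'^T = 1%:M /\
    \forall q \near p, [/\ dom c q, dom c' q,
      coord c q = frame_change A A' (coord c' q) + b
      & forall v, Defs.comp c q v = frame_change A A' (Defs.comp c' q v)].
Proof.
move=> cp c'p; have [A [A' [b [AA H]]]] := transition cp c'p.
exists A, A', b; split => //.
have := near_eq_near H => HH.
near=> q; split.
- by near: q; exact: near_dom.
- by near: q; exact: near_dom.
- by near: q.
- move=> v; have c0q := dom_chart_at q.
  have c'q : dom c' q by near: q; exact: near_dom.
  have [B [B' [b' [BB H']]]] := transition c'q c0q.
  have -> : Defs.comp c' q v = frame_change B B' v.
    exact: (diff_chart_change c0q H').2.
  have Hq : \forall z \near q, coord c z = frame_change A A' (coord c' z) + b.
    by near: q.
  have H2 : \forall z \near q, coord c z =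
     frame_change (B *m A) (B' *m A') (coord (chart_at q) z) + (frame_change A A' b' + b).
    apply: filterS2 Hq H' => z -> ->.
    by rewrite linearD addrA /frame_change /= !mulmxA.
  have -> : Defs.comp c q v = frame_change (B *m A) (B' *m A') v.
    exact: (diff_chart_change c0q H2).2.
  by rewrite /frame_change /= !mulmxA.
Unshelve. all: by end_near. Qed.

Lemma gamma_comp c p u v : dom c p ->
  gamma (Defs.comp c p u) (Defs.comp c p v) = gamma u v.
Proof. by move=> /comp_frame_change[A [A' [AA H _]]]; rewrite !H gamma_frame_change. Qed.

Lemma comp_coord_field c p e : dom c p -> Defs.comp c p (coord_field c e p) = e.
Proof. by move=> /comp_frame_change[A [A' [AA H ->]]]; rewrite H frame_changeVK. Qed.

Lemma coord_field_comp c p v : dom c p -> coord_field c (Defs.comp c p v) p = v.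
Proof. by move=> /comp_frame_change[A [A' [AA -> ->]]]; rewrite frame_changeK. Qed.

Definition loc c X (e : E) : E := Defs.comp c (param c e) (X (param c e)).

Lemma loc_coord c X p : dom c p -> loc c X (coord c p) = Defs.comp c p (X p).
Proof. by move=> cp; rewrite /loc coordK. Qed.

Lemma loc_transition c c' p : dom c p -> dom c' p ->
  exists A A' b, [/\ A *m A'^T = 1%:M,
    coord c p = frame_change A A' (coord c' p) + b,
    forall v, Defs.comp c p v = frame_change A A' (Defs.comp c' p v),
    \forall e \near coord c' p, param c (frame_change A A' e + b) = param c' e
    & forall X, \forall e \near coord c' p,
       loc c X (frame_change A A' e + b) = frame_change A A' (loc c' X e)].
Proof.
move=> cp c'p; have [A [A' [b [AA H]]]] := comp_transition cp c'p.
exists A, A', b; have [_ _ Ep Ev] := nbhs_singleton H.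
have Hp : \forall e \near coord c' p,
    param c (frame_change A A' e + b) = param c' e.
  apply: filterS2 (near_param c'p H) (near_img c'p) => e [ce c'e E1 _] [_ E2].
  by rewrite -[in LHS]E2 -E1 coordK.
split=> // X.
apply: filterS2 (near_param c'p H) Hp => e [ce c'e E1 E2] Ep'.
by rewrite /loc Ep' E2.
Qed.

(** Transition maps are affine near every point, and so preserve smoothness. *)
Lemma smooth_at_chart_fun c c' p f : dom c p -> dom c' p ->
  smooth_at (coord c p) (f \o param c) -> smooth_at (coord c' p) (f \o param c').
Proof.
move=> cp c'p; have [A [A' [b [_ -> _ Hp _]]]] := loc_transition cp c'p.
move=> /(smooth_at_affine_precomp (@frame_change_continuous A A')).
by apply: smooth_at_near; apply: filterS Hp => e /= ->.
Qed.

Lemma smooth_at_chart_field c c' p X : dom c p -> dom c' p ->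
  smooth_at (coord c p) (loc c X) -> smooth_at (coord c' p) (loc c' X).
Proof.
move=> cp c'p; have [A [A' [b [AA -> _ _ Hp]]]] := loc_transition cp c'p.
move=> /(smooth_at_affine_precomp (@frame_change_continuous A A')) sX.
have := smooth_at_linear_comp (@frame_change_continuous A'^T A^T) sX.
apply: smooth_at_near; apply: filterS (Hp X) => e /= ->.
by rewrite frame_changeK.
Qed.

Lemma smooth_fun_at c p f : smooth_fun f -> dom c p ->
  smooth_at (coord c p) (f \o param c).
Proof.
by move=> sf cp; apply: smooth_on_at (sf c); [exact: img_open|exists p].
Qed.

Lemma vector_field_at c p X : vector_field X -> dom c p ->
  smooth_at (coord c p) (loc c X).
Proof.
by move=> sf cp; apply: smooth_on_at (sf c); [exact: img_open|exists p].
Qed.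

Lemma smooth_funP f :
  (forall p, exists2 c, dom c p & smooth_at (coord c p) (f \o param c)) ->
  smooth_fun f.
Proof.
move=> H c; apply: smooth_at_on => _ [p cp <-].
by have [c' c'p] := H p; exact: smooth_at_chart_fun.
Qed.

Lemma vector_fieldP X :
  (forall p, exists2 c, dom c p & smooth_at (coord c p) (loc c X)) ->
  vector_field X.
Proof.
move=> H c; apply: smooth_at_on => _ [p cp <-].
by have [c' c'p] := H p; exact: smooth_at_chart_field.
Qed.

End Charts.

(** * Smooth functions, vector fields and the flat connection *)

Section Fields.
Context {R : realType} {m : nat} {M : flat_biLagrangian R m}.
Local Notation E := (bivec R m).
Local Notation coord := Defs.coord.
Implicit Types (c : chart M) (p q : M) (X Y Z : M -> E) (f : M -> R).

Lemma compZ c p (a : R) v : dom c p -> Defs.comp c p (a *: v) = a *: Defs.comp c p v.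
Proof.
by move=> /comp_frame_change[A [A' [_ H _]]]; rewrite !H /frame_change /= -!scalemxAl.
Qed.

Lemma compD c p u v : dom c p ->
  Defs.comp c p (u + v) = Defs.comp c p u + Defs.comp c p v.
Proof.
by move=> /comp_frame_change[A [A' [_ H _]]]; rewrite !H /frame_change /= !mulmxDl.
Qed.

Lemma smooth_fun_cst (a : R) : smooth_fun (fun=> a : R) (M := M).
Proof.
apply: smooth_funP => p; exists (chart_at p); first exact: dom_chart_at.
exact: smooth_at_cst.
Qed.

Lemma smooth_funD f f' : smooth_fun f -> smooth_fun f' -> smooth_fun (fun p => f p + f' p).
Proof.
move=> sf sf'; apply: smooth_funP => p; exists (chart_at p); first exact: dom_chart_at.
by apply: smooth_atD; apply: smooth_fun_at => //; exact: dom_chart_at.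
Qed.

Lemma smooth_funM f f' : smooth_fun f -> smooth_fun f' -> smooth_fun (fun p => f p * f' p).
Proof.
move=> sf sf'; apply: smooth_funP => p; exists (chart_at p); first exact: dom_chart_at.
by apply: smooth_atM; apply: smooth_fun_at => //; exact: dom_chart_at.
Qed.

Lemma vector_fieldD X Y : vector_field X -> vector_field Y ->
  vector_field (fun p => X p + Y p).
Proof.
move=> sX sY; apply: vector_fieldP => p; have cp := dom_chart_at p.
exists (chart_at p) => //; apply: smooth_at_near (smooth_atD
  (vector_field_at sX cp) (vector_field_at sY cp)).
by apply: filterS (near_img cp) => e [ce _]; rewrite /loc compD.
Qed.

Lemma vector_fieldZ f X : smooth_fun f -> vector_field X ->
  vector_field (fun p => f p *: X p).
Proof.
move=> sf sX; apply: vector_fieldP => p; have cp := dom_chart_at p.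
exists (chart_at p) => //; apply: smooth_at_near (smooth_atZ
  (smooth_fun_at sf cp) (vector_field_at sX cp)).
by apply: filterS (near_img cp) => e [ce _]; rewrite /loc compZ.
Qed.

Lemma smooth_gam X Y : vector_field X -> vector_field Y -> smooth_fun (gam X Y).
Proof.
move=> sX sY; apply: smooth_funP => p; have cp := dom_chart_at p.
exists (chart_at p) => //; apply: (@smooth_at_near _ _ _ _ (fun e => \sum_i
  coordE i (loc (chart_at p) X e) * coordE (dualI i) (loc (chart_at p) Y e))).
  by apply: filterS (near_img cp) => e [ce _]; rewrite -gammaE gamma_comp.
apply: smooth_at_sum => i; apply: smooth_atM.
  exact: (smooth_at_coords _ _).1 (vector_field_at sX cp) i.
exact: (smooth_at_coords _ _).1 (vector_field_at sY cp) (dualI i).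
Qed.

(** nabla0 is defined in the reference chart of each point; flatness of the
    coordinate changes makes it the componentwise derivative in every chart. *)
Lemma derive_loc c p X (v : E) : vector_field X -> dom c p ->
  Defs.comp c p (nabla0_at p v X) = 'D_(Defs.comp c p v) (loc c X) (coord c p).
Proof.
move=> sX cp; have c0p := dom_chart_at p.
have [A [A' [b [AA Ep Ec _ HX]]]] := loc_transition cp c0p.
have d0 := smooth_at_differentiable (vector_field_at sX c0p).
have d := smooth_at_differentiable (vector_field_at sX cp).
rewrite !Ec !comp_chart_at Ep in d *.
rewrite /nabla0_at -/(loc (chart_at p) X).
have cF := @frame_change_continuous _ _ A A'.
pose F : {linear E -> E} := frame_change A A'.
exact: (@derive_intertwine R E E E E F b F _ _ _ v cF cF (HX X) d0 d).
Qed.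

Lemma vector_field_nabla0 X Y : vector_field X -> vector_field Y ->
  vector_field (nabla0 X Y).
Proof.
move=> sX sY; apply: vector_fieldP => p; have cp := dom_chart_at p.
exists (chart_at p) => //; set c := chart_at p.
apply: smooth_at_near (smooth_at_dir_derive (vector_field_at sX cp) (vector_field_at sY cp)).
apply: filterS (near_img cp) => e [ce Ee].
by have := derive_loc (X (param c e)) sY ce; rewrite Ee => H; exact: (esym H).
Qed.

Lemma nabla0_at_linear p Y : vector_field Y -> linear (nabla0_at p ^~ Y).
Proof.
move=> sY a u v.
have d := smooth_at_differentiable (vector_field_at sY (dom_chart_at p)).
by rewrite /nabla0_at !deriveE // linearP.
Qed.

Lemma lder_gam X Y Z p : vector_field Y -> vector_field Z ->
  lder X (gam Y Z) p =
    gamma (nabla0_at p (X p) Y) (Z p) + gamma (Y p) (nabla0_at p (X p) Z).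
Proof.
move=> sY sZ; have cp := dom_chart_at p; rewrite /lder.
rewrite (@near_eq_derive _ _ _ _
  (fun e => gamma (loc (chart_at p) Y e) (loc (chart_at p) Z e))).
  rewrite derive_gamma ?loc_coord ?comp_chart_at //;
    apply: smooth_at_differentiable; exact: vector_field_at.
by apply: filterS (near_img cp) => e [ce _]; rewrite gamma_comp.
Qed.

(** nabla0 being torsion free, the Lie bracket is
    nabla0_X Y - nabla0_Y X. *)
Lemma gamma_bracket0 X Y p z : vector_field X -> vector_field Y ->
  gamma (bracket0 X Y p) z =
    gamma (nabla0_at p (X p) Y) z - gamma (nabla0_at p (Y p) X) z
    - 2^-1 * (gamma (X p) (nabla0_at p z Y) - gamma (Y p) (nabla0_at p z X)).
Proof.
move=> sX sY; rewrite /bracket0 /lie_bracket gammaDl gammaNl /wedge0 gamma_sharp.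
  by rewrite gammaDl gammaNl.
have aux (a x1 x2 y1 y2 : R) : 2^-1 * (a * x1 + x2 - (a * y1 + y2)) =
  a * (2^-1 * (x1 - y1)) + 2^-1 * (x2 - y2) by ring.
move=> a u v; rewrite (nabla0_at_linear p sX a u v) (nabla0_at_linear p sY a u v).
by rewrite !gammaDr !gammaZr; exact: aux.
Qed.

End Fields.

(** * Global extension and tensoriality *)

Section Tensors.
Context {R : realType} {m : nat} {M : flat_biLagrangian R m}.
Local Notation E := (bivec R m).
Local Notation coord := Defs.coord.
Implicit Types (c : chart M) (p q : M) (X Y Z : M -> E) (f : M -> R).

(** Extension by zero: after multiplication by phi, anything smooth on the domain
    of the chart becomes globally smooth.  The support of phi is a compact part
    of the domain, hence closed because the manifold is a Hausdorff space. *)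
Lemma chart_cutoff c p : dom c p -> exists phi : M -> R,
  [/\ \forall q \near p, phi q = 1,
      forall q, phi q != 0 -> dom c q,
      forall f, (forall q, dom c q -> smooth_at (coord c q) (f \o param c)) ->
        smooth_fun (fun q => phi q * f q)
    & forall X, (forall q, dom c q -> smooth_at (coord c q) (loc c X)) ->
        vector_field (fun q => phi q *: X q)].
Proof.
move=> cp; have ce : (coord c @` dom c) (coord c p) by exists p.
have [b [K [sb cK KU b1 b0]]] := smooth_bump (@img_open _ _ _ c) ce.
pose phi q : R := if pselect (dom c q) then b (coord c q) else 0.
have phiE q : dom c q -> phi q = b (coord c q) by rewrite /phi; case: pselect.
have phi_ndom q : ~ dom c q -> phi q = 0 by rewrite /phi; case: pselect.
have phi_dom q : phi q != 0 -> dom c q.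
  by have [//|ncq] := pselect (dom c q); rewrite phi_ndom // eqxx.
have clK : closed (param c @` K).
  apply: compact_closed; first exact: pt_hausdorff.
  apply: continuous_compact => //; apply: continuous_in_subspaceT => e.
  by rewrite inE => /KU; exact: param_continuous.
(* a point outside the domain has a neighbourhood missing the support *)
have phi0 q : ~ dom c q -> \forall q' \near q, phi q' = 0.
  move=> ncq; have : nbhs q (~` (param c @` K)).
    apply: open_nbhs_nbhs; split; first exact: closed_openC.
    by move=> [e /KU [q' cq' <-] E]; apply: ncq; rewrite -E coordK.
  apply: filterS => q' nK; have [cq'|/phi_ndom//] := pselect (dom c q'); rewrite phiE //.
  by apply: b0 => Kq'; apply: nK; exists (coord c q') => //; rewrite coordK.
have sphi q : dom c q -> smooth_at (coord c q) (phi \o param c).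
  move=> cq; apply: (@smooth_at_near _ _ _ _ b).
    by apply: filterS (near_img cq) => e [ce' Ee] /=; rewrite phiE // Ee.
  exact: (smooth_on_at openT).
exists phi; split => //.
- apply: filterS2 (near_dom cp) (near_coord cp b1) => q cq <-; exact: phiE.
- move=> f sf; apply: smooth_funP => q; have [cq|ncq] := pselect (dom c q).
    by exists c => //; apply: smooth_atM; [exact: sphi|exact: sf].
  exists (chart_at q); first exact: dom_chart_at.
  apply: smooth_at_near (smooth_at_cst _ (0 : R)).
  by apply: filterS (near_param (dom_chart_at q) (phi0 q ncq)) => e /= ->; rewrite mul0r.
- move=> X sX; apply: vector_fieldP => q; have [cq|ncq] := pselect (dom c q).
    exists c => //; apply: (@smooth_at_near _ _ _ _
      (fun e => (phi \o param c) e *: loc c X e)).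
      by apply: filterS (near_img cq) => e [ce' _]; rewrite /loc compZ.
    by apply: smooth_atZ; [exact: sphi|exact: sX].
  have c0q := dom_chart_at q; exists (chart_at q) => //.
  apply: smooth_at_near (smooth_at_cst _ (0 : E)).
  apply: filterS2 (near_img c0q) (near_param c0q (phi0 q ncq)) => e [ce' _] phie.
  by rewrite /loc compZ // phie scale0r.
Qed.

Lemma smooth_coord_field c d q : dom c q ->
  smooth_at (coord c q) (loc c (coord_field c d)).
Proof.
move=> cq; apply: smooth_at_near (smooth_at_cst _ d).
by apply: filterS (near_img cq) => e [ce _]; rewrite /loc comp_coord_field.
Qed.

Lemma local_frame c p d : dom c p -> exists2 F : M -> E, vector_field F &
  \forall q \near p, F q = coord_field c d q.
Proof.
move=> cp; have [phi [phi1 _ _ sphi]] := chart_cutoff cp.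
exists (fun q => phi q *: coord_field c d q).
  by apply: sphi => q; exact: smooth_coord_field.
by apply: filterS phi1 => q ->; rewrite scale1r.
Qed.

Lemma vector_field_through p v : exists2 F : M -> E, vector_field F & F p = v.
Proof.
have cp := dom_chart_at p.
have [F sF Fp] := local_frame (Defs.comp (chart_at p) p v) cp.
by exists F => //; rewrite (nbhs_singleton Fp) coord_field_comp.
Qed.

Lemma eq_from_gamma X Y :
  (forall Z p, vector_field Z -> gamma (X p) (Z p) = gamma (Y p) (Z p)) -> X = Y.
Proof.
move=> H; apply/funext => p; apply: gamma_nondeg => w.
by have [F sF <-] := vector_field_through p w; exact: H.
Qed.

Lemma coord_field_decomp c q v : dom c q ->
  v = \sum_i coordE i (Defs.comp c q v) *: coord_field c (basE i) q.
Proof.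
move=> cq; have [A [A' [_ _ HA]]] := comp_frame_change cq.
rewrite -[LHS](coord_field_comp v cq) HA.
rewrite [X in frame_change _ _ X]decompE linear_sum.
by apply: eq_bigr => i _; rewrite linearZ /= HA.
Qed.

Definition tensorial (L : (M -> E) -> M -> R) : Prop :=
  (forall Z Z' p, vector_field Z -> vector_field Z' ->
     L (fun q => Z q + Z' q) p = L Z p + L Z' p) /\
  (forall f Z p, smooth_fun f -> vector_field Z ->
     L (fun q => f q *: Z q) p = f p * L Z p).

Lemma vector_field0 : vector_field (fun=> 0 : E) (M := M).
Proof.
apply: vector_fieldP => p; have cp := dom_chart_at p; exists (chart_at p) => //.
apply: smooth_at_near (smooth_at_cst _ (0 : E)).
apply: filterS (near_img cp) => e [ce _].
by rewrite /loc -[in RHS](scale0r (0 : E)) compZ // scale0r.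
Qed.

Lemma tensorial0 L p : tensorial L -> L (fun=> 0) p = 0.
Proof.
move=> [_ LZ]; have := LZ (fun=> 0) (fun=> 0) p (smooth_fun_cst 0) vector_field0.
by rewrite mul0r; under [X in L X]funext do rewrite scale0r.
Qed.

Lemma tensorial_sum L (I : Type) (r : seq I) (F : I -> M -> E) p :
  tensorial L -> (forall i, vector_field (F i)) ->
  vector_field (fun q => \sum_(i <- r) F i q) /\
  L (fun q => \sum_(i <- r) F i q) p = \sum_(i <- r) L (F i) p.
Proof.
move=> tL sF; elim: r => [|i r [IHv IHL]].
  have -> : (fun q => \sum_(i <- [::]) F i q) = (fun=> 0).
    by apply/funext => q; rewrite big_nil.
  by rewrite big_nil; split; [exact: vector_field0|exact: tensorial0].
have -> : (fun q => \sum_(i <- i :: r) F i q) = (fun q => F i q + \sum_(i <- r) F i q).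
  by apply/funext => q; rewrite big_cons.
split; first exact: vector_fieldD.
by rewrite tL.1 // IHL big_cons.
Qed.

(** A form that is linear over the smooth functions acts pointwise.  If Z vanishes
    at p, then phi^2 Z is a combination of global fields phi d/dx^i with global
    coefficients phi Z^i vanishing at p, where phi(p) = 1. *)
Lemma tensorial_vanish L Z p : tensorial L -> vector_field Z -> Z p = 0 -> L Z p = 0.
Proof.
move=> tL sZ Zp; have cp := dom_chart_at p; set c := chart_at p in cp.
have [phi [phi1 phid sphif sphiX]] := chart_cutoff cp.
have phip : phi p = 1 := nbhs_singleton phi1.
have sphi : smooth_fun phi.
  have := sphif (fun=> 1) (fun q _ => smooth_at_cst _ _).
  by under [X in smooth_fun X]funext do rewrite mulr1.
pose a i q := phi q * coordE i (Defs.comp c q (Z q)).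
pose F i q := phi q *: coord_field c (basE i) q.
have sa i : smooth_fun (a i).
  apply: sphif => q cq; exact: (smooth_at_coords _ _).1 (vector_field_at sZ cq) i.
have sF i : vector_field (F i) by apply: sphiX => q; exact: smooth_coord_field.
have ZE : (fun q => phi q *: (phi q *: Z q)) = (fun q => \sum_i a i q *: F i q).
  apply/funext => q; have [phiq|/phid cq] := eqVneq (phi q) 0.
    by rewrite phiq scale0r big1 // => i _; rewrite /a phiq mul0r scale0r.
  rewrite [in LHS](coord_field_decomp (Z q) cq) !scaler_sumr; apply: eq_bigr => i _.
  by rewrite /F /a !scalerA; congr (_ *: _); ring.
have sphiZ : vector_field (fun q => phi q *: Z q) by exact: vector_fieldZ.
have := congr1 (fun X => L X p) ZE; rewrite /= tL.2 // tL.2 // phip !mul1r => ->.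
rewrite (tensorial_sum _ p tL (fun i => vector_fieldZ (sa i) (sF i))).2.
apply: big1 => i _; rewrite tL.2 // /a Zp.
have -> : Defs.comp c p 0 = 0 by rewrite -(scale0r (0 : E)) compZ // !scale0r.
have -> : coordE i 0 = 0 := linear0 (coordE_linear i).
by rewrite mulr0 mul0r.
Qed.

Lemma tensorial_eq L Z Z' p : tensorial L -> vector_field Z -> vector_field Z' ->
  Z p = Z' p -> L Z p = L Z' p.
Proof.
move=> tL sZ sZ' ZZ; have sN : smooth_fun (fun=> -1 : R) (M := M) := smooth_fun_cst _.
have sNZ := vector_fieldZ sN sZ'.
have := @tensorial_vanish L (fun q => Z q + (-1) *: Z' q) p tL.
rewrite ZZ scaleN1r subrr => /(_ (vector_fieldD sZ sNZ) erefl).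
by rewrite tL.1 // tL.2 // mulN1r => /subr0_eq.
Qed.

(** Since gamma is nondegenerate, a smooth tensorial form is gamma-dual to a
    vector field: the value at p is obtained by evaluating the form on fields
    through the vectors of T_p M, and smoothness is read off local frames. *)
Lemma tensorial_riesz L : tensorial L ->
  (forall Z, vector_field Z -> smooth_fun (L Z)) ->
  exists2 W, vector_field W &
    forall Z p, vector_field Z -> gamma (W p) (Z p) = L Z p.
Proof.
move=> tL sL.
have /choice[ext extP] : forall pv : M * E, exists F : M -> E,
    vector_field F /\ F pv.1 = pv.2.
  by move=> [p v]; have [F sF Fp] := vector_field_through p v; exists F.
have sext pv : vector_field (ext pv) := (extP pv).1.
pose W p := sharp (fun z => L (ext (p, z)) p).
have WE Z p : vector_field Z -> gamma (W p) (Z p) = L Z p.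
  move=> sZ; rewrite gamma_sharp; last first.
    move=> a u v.
    have sa : smooth_fun (fun=> a : R) (M := M) := smooth_fun_cst a.
    have sau := vector_fieldZ sa (sext (p, u)).
    change (L (ext (p, a *: u + v)) p = a * L (ext (p, u)) p + L (ext (p, v)) p).
    rewrite -(tL.2 _ _ p sa (sext (p, u))) -tL.1 //.
    apply: tensorial_eq => //; first exact: vector_fieldD.
    by rewrite !(extP _).2.
  by apply: tensorial_eq => //; rewrite (extP _).2.
exists W => //; apply: vector_fieldP => p; have cp := dom_chart_at p.
set c := chart_at p in cp; exists c => //; apply/smooth_at_coords => i.
have [F sF FE] := local_frame (basE (dualI i)) cp.
apply: smooth_at_near (smooth_fun_at (sL F sF) cp).
apply: filterS2 (near_img cp) (near_param cp FE) => e [ce _] Fe.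
rewrite -gamma_basE -(comp_coord_field (basE (dualI i)) ce) gamma_comp // -Fe.
exact/esym/WE.
Qed.

End Tensors.

(** * The Gualtieri torsion of a connection preserving gamma *)

Section Torsion.
Context {R : realType} {m : nat} {M : flat_biLagrangian R m}.
Local Notation E := (bivec R m).
Context (D : (M -> E) -> (M -> E) -> M -> E).
Context (conn : connectionTM D).
Context (metric : preserves id (@vector_field R m M) (@vector_field R m M) (@gam R m M) D).
Implicit Types (p : M) (X Y Z : M -> E).

Let T := gualtieri_torsion D.

(** The coefficients of nabla0 and of D, lowered with gamma.  All the identities
    below become linear relations between their values on the permutations of
    three fields. *)
Definition component0 X Y Z p : R := gamma (nabla0_at p (X p) Y) (Z p).
Definition component X Y Z p : R := gamma (D X Y p) (Z p).
Local Notation n := component0.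
Local Notation a := component.

Lemma lder_component X Y Z p : vector_field X -> vector_field Y -> vector_field Z ->
  lder X (gam Y Z) p = a X Y Z p + a X Z Y p.
Proof.
move=> sX sY sZ; have := congr1 (fun f => f p) (metric sX sY sZ).
by move=> /= ->; rewrite /gam (gammaC (Y p)).
Qed.

Lemma lder_component0 X Y Z p : vector_field Y -> vector_field Z ->
  lder X (gam Y Z) p = n X Y Z p + n X Z Y p.
Proof. by move=> sY sZ; rewrite lder_gam // /n (gammaC (Y p)). Qed.

Lemma bracket0_component X Y Z p : vector_field X -> vector_field Y ->
  gamma (bracket0 X Y p) (Z p) =
    n X Y Z p - n Y X Z p - 2^-1 * (n Z Y X p - n Z X Y p).
Proof.
by move=> sX sY; rewrite gamma_bracket0 // /n !(gammaC _ (nabla0_at p (Z p) _)).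
Qed.

(** D and nabla0 both preserve gamma, so their difference, lowered with gamma,
    is skew in its last two arguments.  Substituting this in the definition of the
    Gualtieri torsion leaves the cyclic sum of that difference. *)
Lemma torsion_cyclic X Y Z p : vector_field X -> vector_field Y -> vector_field Z ->
  T X Y Z p = (a X Y Z p - n X Y Z p) + (a Y Z X p - n Y Z X p)
              + (a Z X Y p - n Z X Y p).
Proof.
move=> sX sY sZ; rewrite /T /gualtieri_torsion !gammaDl !gammaNl.
rewrite bracket0_component //.
have mY := lder_component p sY sX sZ; rewrite lder_component0 // in mY.
have mZ := lder_component p sZ sX sY; rewrite lder_component0 // in mZ.
rewrite -/(a X Y Z p) -/(a Y X Z p) -/(a Z X Y p) -/(a Z Y X p).
move: mY mZ; generalize (a X Y Z p) (a X Z Y p) (a Y X Z p)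
  (a Y Z X p) (a Z X Y p) (a Z Y X p)
  (n X Y Z p) (n X Z Y p) (n Y X Z p) (n Y Z X p) (n Z X Y p) (n Z Y X p).
by move=> *; lra.
Qed.

Lemma torsion_rot X Y Z p : vector_field X -> vector_field Y -> vector_field Z ->
  T X Y Z p = T Y Z X p.
Proof. move=> sX sY sZ; rewrite (torsion_cyclic p sX sY sZ) (torsion_cyclic p sY sZ sX).
by rewrite [RHS]addrC [RHS]addrA. Qed.

Lemma torsion_skew12 X Y Z p : vector_field X -> vector_field Y -> vector_field Z ->
  T Y X Z p = - T X Y Z p.
Proof.
move=> sX sY sZ; rewrite (torsion_cyclic p sX sY sZ) (torsion_cyclic p sY sX sZ).
have mX := lder_component p sX sY sZ; rewrite lder_component0 // in mX.
have mY := lder_component p sY sX sZ; rewrite lder_component0 // in mY.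
have mZ := lder_component p sZ sX sY; rewrite lder_component0 // in mZ.
move: mX mY mZ; generalize (a X Y Z p) (a X Z Y p) (a Y X Z p)
  (a Y Z X p) (a Z X Y p) (a Z Y X p)
  (n X Y Z p) (n X Z Y p) (n Y X Z p) (n Y Z X p) (n Z X Y p) (n Z Y X p).
by move=> *; lra.
Qed.

Lemma torsion_skew23 X Y Z p : vector_field X -> vector_field Y -> vector_field Z ->
  T X Z Y p = - T X Y Z p.
Proof.
move=> sX sY sZ; rewrite (torsion_rot _ sX sZ sY) torsion_skew12 //.
by rewrite -torsion_rot.
Qed.

(** The last argument enters the definition either algebraically or as the
    direction of a covariant derivative. *)
Lemma torsion_tensorial X Y : vector_field X -> vector_field Y -> tensorial (T X Y).
Proof.
move=> sX sY; have [_ CD _ CZ _] := conn.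
have aux (x1 x2 y1 y2 z1 z2 : R) : x1 + x2 + 2^-1 * (y1 + y2 - (z1 + z2)) =
  x1 + 2^-1 * (y1 - z1) + (x2 + 2^-1 * (y2 - z2)) by ring.
have aux' (f x y z : R) : f * x + 2^-1 * (f * y - f * z) =
  f * (x + 2^-1 * (y - z)) by ring.
split=> [Z Z' p sZ sZ'|f Z p sf sZ]; rewrite /T /gualtieri_torsion.
  by rewrite !(CD Z Z') // gammaDr (gammaDl _ (D Z X p)) (gammaDl _ (D Z Y p)) aux.
by rewrite !(CZ f Z) // gammaZr (gammaZl _ _ (D Z X p)) (gammaZl _ _ (D Z Y p)) aux'.
Qed.

Lemma smooth_torsion X Y Z : vector_field X -> vector_field Y -> vector_field Z ->
  smooth_fun (T X Y Z).
Proof.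
move=> sX sY sZ; have [CV _ _ _ _] := conn.
have sd U V W : vector_field U -> vector_field V -> vector_field W ->
    smooth_fun (fun p => a U V W p - n U V W p).
  move=> sU sV sW.
  have -> : (fun p => a U V W p - n U V W p) =
     (fun p => gam (D U V) W p + (-1) * gam (nabla0 U V) W p).
    by apply/funext => p; rewrite mulN1r.
  apply: smooth_funD; first by apply: smooth_gam => //; exact: CV.
  apply: smooth_funM; first exact: smooth_fun_cst.
  by apply: smooth_gam => //; exact: vector_field_nabla0.
have -> : T X Y Z = (fun p => (a X Y Z p - n X Y Z p) + (a Y Z X p - n Y Z X p)
              + (a Z X Y p - n Z X Y p)).
  by apply/funext => p; exact: torsion_cyclic.
by apply: smooth_funD; [apply: smooth_funD|]; exact: sd.
Qed.

Lemma torsion_field_exists : exists W : (M -> E) -> (M -> E) -> M -> E,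
  forall X Y, vector_field X -> vector_field Y -> vector_field (W X Y) /\
    forall Z p, vector_field Z -> gamma (W X Y p) (Z p) = T X Y Z p.
Proof.
have /choice[W HW] : forall XY : (M -> E) * (M -> E), exists F : M -> E,
    vector_field XY.1 -> vector_field XY.2 -> vector_field F /\
    forall Z p, vector_field Z -> gamma (F p) (Z p) = T XY.1 XY.2 Z p.
  move=> [X Y] /=; have [[sX sY]|nXY] := pselect (vector_field X /\ vector_field Y).
    have [F sF HF] := tensorial_riesz (torsion_tensorial sX sY)
      (fun Z sZ => smooth_torsion sX sY sZ).
    by exists F.
  by exists (fun=> 0) => sX sY; case: nXY.
by exists (fun X Y => W (X, Y)) => X Y; exact: (HW (X, Y)).
Qed.

End Torsion.

(** * The splitting of the tangent bundle defined by a field *)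

Section Field.
Context {R : realType} {m : nat} {M : flat_biLagrangian R m}.
Local Notation E := (bivec R m).
Local Notation coord := Defs.coord.
Context (g B : M -> 'M[R]_m).
Local Notation iota := (Defs.iota g B).
Implicit Types (p : M) (X Y Z : M -> E).

(** The L-component of a vector field is a section of L, as the frame changes
    preserve the splitting. *)
Lemma sectionL_through p (x : 'rV[R]_m) : exists2 X : M -> 'rV[R]_m, sectionL X & X p = x.
Proof.
have [F sF Fp] := vector_field_through p (inL x : E).
exists (fun q => (F q).1); last by rewrite Fp.
apply: vector_fieldP => q; have cq := dom_chart_at q.
exists (chart_at q) => //; apply/smooth_at_coords => -[] i.
  apply: smooth_at_near ((smooth_at_coords _ _).1 (vector_field_at sF cq) (inl i)).
  apply: filterS (near_img cq) => e [ce _]; rewrite /loc.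
  by have [A [A' [_ HA _]]] := comp_frame_change ce; rewrite !HA.
apply: smooth_at_near (smooth_at_cst _ (0 : R)).
apply: filterS (near_img cq) => e [ce _]; rewrite /loc.
by have [A [A' [_ HA _]]] := comp_frame_change ce; rewrite HA /= mul0mx mxE.
Qed.

Lemma bil_delta (h P : 'M[R]_m) i j :
  bil h (delta_mx 0 i *m P) (delta_mx 0 j *m P) = (P *m h *m P^T) i j.
Proof.
rewrite /bil trmx_mul trmx_delta !mulmxA -!(mulmxA (delta_mx 0 i)).
by rewrite -rowE -colE !mxE.
Qed.

(** In a chart, iota X has the components xi and xi G, where xi represents X and G
    the form B + g or B - g in the coordinate frame. *)
Lemma vector_field_iota s (X : M -> 'rV[R]_m) : smooth_form g -> smooth_form B ->
  sectionL X -> vector_field (iota s X).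
Proof.
move=> sg sB sX; apply: vector_fieldP => p; have cp := dom_chart_at p.
set c := chart_at p in cp; exists c => //; apply/smooth_at_coords => k.
have sXi i := (smooth_at_coords _ _).1 (vector_field_at sX cp) (inl i).
have sh h (i j : 'I_m) : smooth_form h -> smooth_at (coord c p) (fun e =>
    bil (h (param c e)) (coord_field c (delta_mx 0 i, 0) (param c e)).1
                        (coord_field c (delta_mx 0 j, 0) (param c e)).1).
  by move=> sh; apply: smooth_on_at (sh c i j); [exact: img_open|exists p].
case: k => [i|j].
  apply: smooth_at_near (sXi i).
  apply: filterS (near_img cp) => e [ce _]; rewrite /loc.
  by have [A [A' [_ HA _]]] := comp_frame_change ce; rewrite !HA.
apply: (@smooth_at_near _ _ _ _ (fun e => \sum_i
   coordE (inl i) (loc c (inL \o X) e) *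
   (bil (B (param c e)) (coord_field c (delta_mx 0 i, 0) (param c e)).1
        (coord_field c (delta_mx 0 j, 0) (param c e)).1
    + (-1) ^+ s * bil (g (param c e)) (coord_field c (delta_mx 0 i, 0) (param c e)).1
        (coord_field c (delta_mx 0 j, 0) (param c e)).1))).
  apply: filterS (near_img cp) => e [ce _]; rewrite /loc.
  have [A [A' [AA HA HF]]] := comp_frame_change ce; rewrite !HA /=.
  set q := param c e.
  transitivity ((X q *m A *m (A'^T *m (B q + (-1) ^+ s *: g q) *m A')) 0 j).
    rewrite [RHS]mxE; apply: eq_bigr => i _; congr (_ * _).
    rewrite !HF /= !bil_delta trmxK mulmxDr mulmxDl -scalemxAr -scalemxAl.
    by rewrite [RHS]mxE [X in _ = _ + X]mxE.
  by rewrite !mulmxA -(mulmxA _ A) AA mulmx1.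
apply: smooth_at_sum => i; apply: smooth_atM; first exact: sXi.
apply: smooth_atD; first exact: sh.
by apply: smooth_atM; [exact: smooth_at_cst|exact: sh].
Qed.

(** The involution that is 1 on S_+ and -1 on S_-, at the point p. *)
Definition splitting_involution p (u : E) : E :=
  let y := (u.2 - u.1 *m B p) *m invmx (g p) in (y, y *m B p + u.1 *m g p).

Definition iota_at s p (x : 'rV[R]_m) : E := (x, x *m (B p + (-1) ^+ s *: g p)).

(** The generalized metric is gamma twisted by the involution; the skewness of B
    accounts for the cross terms. *)
Lemma gen_metric_involution X Y p : (B p)^T = - B p ->
  gen_metric g B X Y p = gamma (splitting_involution p (X p)) (Y p).
Proof.
move=> BT; rewrite /gen_metric /bil /gamma /splitting_involution /=.
set y := (_.2 - _) *m invmx _.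
have scalT (u v : 'rV[R]_m) : (u *m v^T) 0 0 = (v *m u^T) 0 0.
  by rewrite -[in RHS](trmxK v) -trmx_mul [RHS]mxE.
have -> : (X p).1 *m B p - (X p).2 = - ((X p).2 - (X p).1 *m B p) by rewrite opprB.
rewrite [X in _ = _ + X]scalT mulNmx -/y linearB /= trmx_mul BT.
rewrite mulmxDl mulNmx mulmxBr mulNmx mulmxN !mulmxA.
rewrite !mxE; lra.
Qed.

(** TM = S_+ + S_-: for u = (x, xi), the components a and b have sum x, and
    difference y with y g = xi - x B. *)
Lemma splitting_decomp p (u : E) : g p \in unitmx -> exists a b,
  u = iota_at false p a + iota_at true p b /\
  splitting_involution p u = iota_at false p a - iota_at true p b.
Proof.
move=> gU; pose y := (u.2 - u.1 *m B p) *m invmx (g p).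
pose a := 2^-1 *: (u.1 + y); pose b := 2^-1 *: (u.1 - y).
have half (v : 'rV[R]_m) : 2^-1 *: (v + v) = v.
  by rewrite scalerDr -scalerDl (_ : 2^-1 + 2^-1 = 1 :> R) ?scale1r //; lra.
have abD : a + b = u.1.
  by rewrite /a /b -scalerDr addrACA subrr addr0 half.
have abB : a - b = y.
  by rewrite /a /b -scalerBr opprB addrC subrKA half.
have gy : y *m g p = u.2 - u.1 *m B p by rewrite /y mulmxKV.
have E1 (s : bool) x : x *m (B p + (-1) ^+ s *: g p) = x *m B p + (-1) ^+ s *: (x *m g p).
  by rewrite mulmxDr -scalemxAr.
exists a, b; split.
  rewrite /iota_at !E1 expr0 expr1 scale1r scaleN1r.
  apply: injective_projections => /=; first by rewrite abD.
  by rewrite addrACA -mulmxDl -mulmxBl abD abB gy addrC subrK.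
rewrite /iota_at !E1 expr0 expr1 scale1r scaleN1r /splitting_involution -/y.
apply: injective_projections => /=; first by rewrite abB.
by rewrite opprD opprK addrACA -mulmxBl -mulmxDl abD abB.
Qed.

End Field.

Lemma gen_metric_sym (R : realType) (m : nat) (M : flat_biLagrangian R m)
    (g B : M -> 'M[R]_m) X Y (x : M) : (g x)^T = g x ->
  gen_metric g B X Y x = gen_metric g B Y X x.
Proof.
move=> gT; have bilC (A : 'M[R]_m) (u v : 'rV[R]_m) : A^T = A -> bil A u v = bil A v u.
  by move=> AT; rewrite /bil -[in RHS]AT -[in RHS](trmxK v) -!trmx_mul [RHS]mxE mulmxA.
by rewrite /gen_metric bilC // [X in _ + X]bilC // trmx_inv gT.
Qed.

(** * Vanishing mixed torsion and the generalized metric *)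

Section Mixed.
Context {R : realType} {m : nat} {M : flat_biLagrangian R m}.
Local Notation E := (bivec R m).
Context (g B : M -> 'M[R]_m) (sg : smooth_form g) (sB : smooth_form B).
Context (D : (M -> E) -> (M -> E) -> M -> E) (conn : connectionTM D).
Context (metric : preserves id (@vector_field R m M) (@vector_field R m M) (@gam R m M) D).
Context (mixed : mixed_torsion_free g B D).
Local Notation T := (gualtieri_torsion D).
Local Notation iota := (Defs.iota g B).
Implicit Types (p : M) (X Y Z : M -> E).

Lemma torsion_add1 X X1 X2 Y Z p : vector_field X -> vector_field X1 -> vector_field X2 ->
  vector_field Y -> vector_field Z -> X p = X1 p + X2 p ->
  T X Y Z p = T X1 Y Z p + T X2 Y Z p.
Proof.
move=> sX sX1 sX2 sY sZ EX.
have sX12 := vector_fieldD sX1 sX2.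
rewrite (torsion_rot metric _ sX sY sZ) (torsion_rot metric _ sX1 sY sZ).
rewrite (torsion_rot metric _ sX2 sY sZ).
have tl := torsion_tensorial conn sY sZ.
by rewrite (tensorial_eq tl sX sX12 EX) tl.1.
Qed.

(** Splitting X and Y along S_+ and S_-, every term but one is a mixed component
    of the torsion. *)
Lemma torsion_pure s (x : bool -> M -> 'rV[R]_m) (y : bool -> M -> 'rV[R]_m)
    (z : M -> 'rV[R]_m) X Y p :
  (forall t, sectionL (x t)) -> (forall t, sectionL (y t)) -> sectionL z ->
  vector_field X -> vector_field Y ->
  X p = iota false (x false) p + iota true (x true) p ->
  Y p = iota false (y false) p + iota true (y true) p ->
  T X Y (iota s z) p = T (iota s (x s)) (iota s (y s)) (iota s z) p.
Proof.
move=> sx sy sz sX sY EX EY.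
have vi t w : sectionL w -> vector_field (iota t w) by exact: vector_field_iota.
have mix t1 t2 : ~~ ((t1 == t2) && (t2 == s)) ->
    T (iota t1 (x t1)) (iota t2 (y t2)) (iota s z) p = 0.
  move=> H; have := @mixed t1 t2 s _ _ _ H (sx t1) (sy t2) sz.
  by move=> /(congr1 (fun f => f p)).
have split t : T (iota t (x t)) Y (iota s z) p =
    T (iota t (x t)) (iota false (y false)) (iota s z) p
    + T (iota t (x t)) (iota true (y true)) (iota s z) p.
  have vx := vi t _ (sx t); have vz := vi s _ sz.
  have v0 := vi false _ (sy false); have v1 := vi true _ (sy true).
  rewrite (torsion_rot metric _ vx sY vz) (torsion_add1 sY v0 v1 vz vx EY).
  by rewrite -(torsion_rot metric _ vx v0 vz) -(torsion_rot metric _ vx v1 vz).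
rewrite (torsion_add1 sX (vi _ _ (sx false)) (vi _ _ (sx true)) sY (vi _ _ sz) EX).
rewrite !split; case: (s) mix => mix.
  by rewrite (mix false false) // (mix false true) // (mix true false) // !add0r.
by rewrite (mix true true) // (mix false true) // (mix true false) // !addr0.
Qed.

(** Both T(X, Y, J Z) and T(X, J Y, Z) reduce to the difference of the pure
    components T(X+, Y+, Z+) - T(X-, Y-, Z-), so they agree.  This
    is the preservation of the generalized metric by a deformation
    proportional to T. *)
Lemma torsion_involution W X Y Z p : g p \in unitmx ->
  vector_field X -> vector_field Y -> vector_field Z ->
  (forall X Y Z, vector_field X -> vector_field Y -> vector_field Z ->
     gamma (W X Y p) (Z p) = T X Y Z p) ->
  gamma (W X Y p) (splitting_involution g B p (Z p))
  + gamma (W X Z p) (splitting_involution g B p (Y p)) = 0.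
Proof.
move=> gU sX sY sZ HW.
have dec U : exists u : bool -> M -> 'rV[R]_m, [/\ forall t, sectionL (u t),
    U p = iota false (u false) p + iota true (u true) p
    & splitting_involution g B p (U p) = iota false (u false) p - iota true (u true) p].
  have [a [b [E1 E2]]] := splitting_decomp B (U p) gU.
  have [Fa sFa Ea] := sectionL_through p a; have [Fb sFb Eb] := sectionL_through p b.
  exists (fun t => if t then Fb else Fa); split; first by case.
    by rewrite {1}E1 /Defs.iota /iota_at Ea Eb.
  by rewrite E2 /Defs.iota /iota_at Ea Eb.
have [x [sx Ex _]] := dec X; have [y [sy Ey fy]] := dec Y.
have [z [sz Ez fz]] := dec Z.
have vi t w : sectionL w -> vector_field (iota t w) by exact: vector_field_iota.
rewrite fy fz !gammaDr !gammaNr !HW //; try exact: vi.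
have vx t := vi t _ (sx t); have vy t := vi t _ (sy t); have vz t := vi t _ (sz t).
rewrite !(torsion_pure _ sx sy _ sX sY Ex Ey) // !(torsion_pure _ sx sz _ sX sZ Ex Ez) //.
rewrite (torsion_skew23 metric _ (vx false) (vy false) (vz false)).
rewrite (torsion_skew23 metric _ (vx true) (vy true) (vz true)).
by rewrite opprK addrACA subrr add0r addrC subrr.
Qed.

End Mixed.

Theorem proposition5p4 (R : realType) (m p q : nat)
  (M : flat_biLagrangian R m)
  (g B : M -> 'M[R]_m) (hgB : is_field p q g B)
  (nabla1 : (M -> bivec R m) -> (M -> bivec R m) -> M -> bivec R m)
  (hnabla1 : CWT g B nabla1) :
  let property (nabla : (M -> bivec R m) -> (M -> bivec R m) -> M -> bivec R m) :=
    [/\ double_metric g B nabla,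
        torsion_free nabla,
        totally_skew (deformation nabla nabla1)
      & forall X Y Z, vector_field X -> vector_field Y -> vector_field Z ->
        forall x : M,
          3 * Alt (deformation nabla nabla1) X Y Z x =
            gam (bracket0 X Y) Z x + gam (bracket0 Y Z) X x
            + gam (bracket0 X Z) Y x
            - 2^-1 * (lder X (gam Y Z) x - lder Y (gam Z X) x
                      - 3 * lder Z (gam X Y) x)
            - (gam (nabla1 X Y) Z x + gam (nabla1 Y Z) X x
               + gam (nabla1 Z X) Y x)] in
  exists2 nabla, property nabla &
    forall nabla', property nabla' ->
      forall X Y, vector_field X -> vector_field Y -> nabla' X Y = nabla X Y.
Proof.
have [_ sg hg sB hB] := hgB.
have [[conn metric gmetric] mixed _] := hnabla1.
have [CV CDl CDr CZl CL] := conn.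
move=> property.
pose T := gualtieri_torsion nabla1.
have [W HW] := torsion_field_exists conn metric.
have sW X Y : vector_field X -> vector_field Y -> vector_field (W X Y).
  by move=> sX sY; exact: (HW X Y sX sY).1.
have WE X Y Z x : vector_field X -> vector_field Y -> vector_field Z ->
    gamma (W X Y x) (Z x) = T X Y Z x.
  by move=> sX sY sZ; exact: (HW X Y sX sY).2.
(* W is T^sharp, and nabla is nabla1 + k W with k = - 1 / 3 *)
pose k : R := - 3^-1.
pose nabla X Y x := nabla1 X Y x + k *: W X Y x.
have dE X Y Z x : vector_field X -> vector_field Y -> vector_field Z ->
    deformation nabla nabla1 X Y Z x = k * T X Y Z x.
  move=> sX sY sZ.
  by rewrite /deformation /nabla addrAC subrr add0r gammaZl WE.
have torsion_deform nb X Y Z x : totally_skew (deformation nb nabla1) ->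
    vector_field X -> vector_field Y -> vector_field Z ->
    gualtieri_torsion nb X Y Z x = T X Y Z x + 3 * deformation nb nabla1 X Y Z x.
  move=> sk sX sY sZ.
  have E1 := congr1 (fun f => f x) (sk _ _ _ sX sY sZ).1.
  have E2 := congr1 (fun f => f x) (sk _ _ _ sX sZ sY).1.
  have E3 := congr1 (fun f => f x) (sk _ _ _ sZ sY sX).1.
  have E4 := congr1 (fun f => f x) (sk _ _ _ sX sY sZ).2.
  have E5 := congr1 (fun f => f x) (sk _ _ _ sY sX sZ).2.
  have e A C U : gamma (nb A C x) (U x) =
      deformation nb nabla1 A C U x + gamma (nabla1 A C x) (U x).
    by rewrite /deformation -gammaDl subrK.
  rewrite /T /gualtieri_torsion !gammaDl !gammaNl !e.
  move: E1 E2 E3 E4 E5 => /=.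
  generalize (deformation nb nabla1 X Y Z x) (deformation nb nabla1 Y X Z x)
    (deformation nb nabla1 X Z Y x) (deformation nb nabla1 Z X Y x)
    (deformation nb nabla1 Y Z X x) (deformation nb nabla1 Z Y X x).
  generalize (gamma (nabla1 X Y x) (Z x)) (gamma (nabla1 Y X x) (Z x))
    (gamma (bracket0 X Y x) (Z x)) (gamma (nabla1 Z X x) (Y x))
    (gamma (nabla1 Z Y x) (X x)).
  by move=> *; lra.
have skew : totally_skew (deformation nabla nabla1).
  move=> X Y Z sX sY sZ; split; apply/funext => x; rewrite !dE //.
    by rewrite /T (torsion_skew12 metric) // mulrN.
  by rewrite /T (torsion_skew23 metric) // mulrN.
have WDl X X' Y : vector_field X -> vector_field X' -> vector_field Y ->
    W (fun x => X x + X' x) Y = (fun x => W X Y x + W X' Y x).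
  move=> sX sX' sY; have sXX := vector_fieldD sX sX'.
  apply: eq_from_gamma => Z x sZ; rewrite gammaDl !WE // /T.
  by apply: (torsion_add1 conn metric) => //.
have WZl f X Y : smooth_fun f -> vector_field X -> vector_field Y ->
    W (fun x => f x *: X x) Y = (fun x => f x *: W X Y x).
  move=> sf sX sY; have sfX := vector_fieldZ sf sX.
  apply: eq_from_gamma => Z x sZ; rewrite gammaZl !WE // /T.
  rewrite (torsion_rot metric _ sfX sY sZ) (torsion_rot metric _ sX sY sZ).
  exact: (torsion_tensorial conn sY sZ).2.
have Wskew X Y : vector_field X -> vector_field Y ->
    W Y X = (fun x => - W X Y x).
  move=> sX sY; apply: eq_from_gamma => Z x sZ; rewrite gammaNl !WE //.
  exact: (torsion_skew12 metric).
exists nabla; last first.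
  move=> nb [_ tf sk _] X Y sX sY; apply: eq_from_gamma => Z x sZ.
  have := congr1 (fun f => f x) (tf X Y Z sX sY sZ).
  rewrite /= torsion_deform // /nabla gammaDl gammaZl WE //.
  have -> : gamma (nb X Y x) (Z x) =
      deformation nb nabla1 X Y Z x + gamma (nabla1 X Y x) (Z x).
    by rewrite /deformation -gammaDl subrK.
  rewrite /k; generalize (deformation nb nabla1 X Y Z x) (T X Y Z x)
    (gamma (nabla1 X Y x) (Z x)).
  by move=> *; lra.
split.
- split.
  + split.
    * move=> X Y sX sY; apply: vector_fieldD; first exact: CV.
      by apply: vector_fieldZ; [exact: smooth_fun_cst|exact: sW].
    * move=> X X' Y sX sX' sY; apply/funext => x.
      by rewrite /nabla CDl // WDl // scalerDr addrACA.
    * move=> X Y Y' sX sY sY'; apply/funext => x.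
      rewrite /nabla CDr // (Wskew (fun q => Y q + Y' q)) //; last exact: vector_fieldD.
      rewrite WDl // (Wskew Y X) // (Wskew Y' X) //.
      by rewrite opprD scalerDr addrACA.
    * move=> f X Y sf sX sY; apply/funext => x.
      by rewrite /nabla CZl // WZl // scalerDr !scalerA (mulrC k).
    * move=> f X Y sf sX sY; apply/funext => x.
      rewrite /nabla CL // (Wskew (fun q => f q *: Y q)) //; last exact: vector_fieldZ.
      rewrite WZl // (Wskew Y X) //.
      by rewrite -scalerN scalerDr !scalerA (mulrC k) addrA.
  + move=> X Y Z sX sY sZ; rewrite (metric X Y Z) //; apply/funext => x.
    rewrite /gam /nabla gammaDl gammaDr gammaZl gammaZr WE // (gammaC (Y x) (W X Z x)) WE //.
    rewrite /T (torsion_skew23 metric x sX sY sZ).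
    generalize (gualtieri_torsion nabla1 X Y Z x) => t.
    by rewrite mulrN [RHS]addrACA subrr addr0.
  + move=> X Y Z sX sY sZ; rewrite (gmetric X Y Z) //; apply/funext => x.
    have [gT gU _] := hg x.
    have gen U V : gen_metric g B U V x = gamma (V x) (splitting_involution g B x (U x)).
      by rewrite gen_metric_involution // gammaC.
    have genC U V : gen_metric g B U V x = gen_metric g B V U x.
      exact: gen_metric_sym.
    rewrite (genC _ Z) (genC (nabla X Y) Z) !gen /nabla !gammaDl !gammaZl.
    have := torsion_involution sg sB conn metric mixed gU sX sY sZ
       (fun X Y Z sX sY sZ => WE X Y Z x sX sY sZ).
    move=> /(congr1 (fun t => k * t)); rewrite mulr0 mulrDr => H.
    by rewrite [RHS]addrACA H addr0.
- move=> X Y Z sX sY sZ; apply/funext => x; rewrite torsion_deform // dE // /k.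
  by generalize (T X Y Z x) => t; lra.
- exact: skew.
- move=> X Y Z sX sY sZ x.
  rewrite /Alt !dE // /T.
  have E1 := torsion_rot metric x sX sY sZ.
  have E2 := torsion_rot metric x sZ sX sY.
  have E3 := torsion_skew12 metric x sX sY sZ.
  have E4 := torsion_skew23 metric x sX sY sZ.
  have E5 := torsion_skew12 metric x sY sZ sX.
  rewrite E5 -E1 E2 E3 E4.
  have L1 := lder_component0 X x sY sZ.
  have L2 := lder_component0 Y x sZ sX.
  have L3 := lder_component0 Z x sX sY.
  have B1 := bracket0_component Z x sX sY.
  have B2 := bracket0_component X x sY sZ.
  have B3 := bracket0_component Y x sX sZ.
  have C := torsion_cyclic metric x sX sY sZ.
  rewrite /gam L1 L2 L3; move: C B1 B2 B3.
  rewrite -/(component nabla1 X Y Z x) -/(component nabla1 Y Z X x)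
    -/(component nabla1 Z X Y x) /k.
  generalize (gualtieri_torsion nabla1 X Y Z x) (gamma (bracket0 X Y x) (Z x))
    (gamma (bracket0 Y Z x) (X x)) (gamma (bracket0 X Z x) (Y x))
    (component nabla1 X Y Z x) (component nabla1 Y Z X x)
    (component nabla1 Z X Y x) (component0 X Y Z x) (component0 X Z Y x)
    (component0 Y X Z x) (component0 Y Z X x)
    (component0 Z X Y x) (component0 Z Y X x).
  by clear; move=> *; lra.
Qed.
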